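(* Let $S\in\mathcal S_d(\mathcal U,\mathcal Y)$ and let $\mathcal H(K_S)$ be the associated de Branges–Rovnyak space. Then: (1) There exist bounded operators $A_j:\mathcal H(K_S)\to\mathcal H(K_S)$, $j=1,\dots,d$, such that $$f(\lambda)-f(0)=\sum_{j=1}^d\lambda_j(A_jf)(\lambda)\quad\text{for every }f\in\mathcal H(K_S)\text{ and }\lambda\in\mathbb B^d,\qquad(\text{i})$$ and $$\sum_{j=1}^d\|A_jf\|^2_{\mathcal H(K_S)}\le\|f\|^2_{\mathcal H(K_S)}-\|f(0)\|^2_{\mathcal Y}\quad\text{for every }f\in\mathcal H(K_S).\qquad(\text{ii})$$ (2) For operators $A_1,\dots,A_d$ on $\mathcal H(K_S)$ satisfying (i) and (ii), there is a weakly coisometric realization $$S(\lambda)=D+C(I-Z(\lambda)A)^{-1}Z(\lambda)B\qquad(\lambda\in\mathbb B^d)$$ of $S$ with state space $\mathcal X=\mathcal H(K_S)$, with these state operators $A_1,\dots,A_d$, and with the operator $C:\mathcal H(K_S)\to\mathcal Y$ defined by $Cf=f(0)$ for all $f\in\mathcal H(K_S)$.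
   Context: $\mathcal U,\mathcal Y,\mathcal X$ are Hilbert spaces and $\mathcal L(\cdot,\cdot)$ denotes bounded linear operators. $\mathbb B^d$ is the open unit ball of $\mathbb C^d$ with inner product $\langle\lambda,\zeta\rangle=\sum_j\lambda_j\overline{\zeta_j}$; $\mathcal H(k_d)$ is the reproducing kernel Hilbert space on $\mathbb B^d$ with kernel $k_d(\lambda,\zeta)=1/(1-\langle\lambda,\zeta\rangle)$ and $\mathcal H_{\mathcal Y}(k_d)=\mathcal H(k_d)\otimes\mathcal Y$, viewed as a space of $\mathcal Y$-valued functions. $\mathcal S_d(\mathcal U,\mathcal Y)$ is the set of $\mathcal L(\mathcal U,\mathcal Y)$-valued analytic functions $S$ on $\mathbb B^d$ such that $f\mapsto S f$ is a contraction from $\mathcal H_{\mathcal U}(k_d)$ into $\mathcal H_{\mathcal Y}(k_d)$. For such $S$, $K_S(\lambda,\zeta)=\dfrac{I_{\mathcal Y}-S(\lambda)S(\zeta)^*}{1-\langle\lambda,\zeta\rangle}$ is a positive kernel on $\mathbb B^d$, and the de Branges–Rovnyak space $\mathcal H(K_S)$ is the reproducing kernel Hilbert space of $\mathcal Y$-valued functions with kernel $K_S$. For $A_1,\dots,A_d\in\mathcal L(\mathcal X)$ and $B_1,\dots,B_d\in\mathcal L(\mathcal U,\mathcal X)$, $A:\mathcal X\to\mathcal X^d$ and $B:\mathcal U\to\mathcal X^d$ are the columns with entries $A_j$ and $B_j$, and $Z(\lambda)=[\lambda_1I_{\mathcal X}\ \cdots\ \lambda_dI_{\mathcal X}]:\mathcal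 X^d\to\mathcal X$. The realization with connecting operator $\mathbf U=\begin{bmatrix}A&B\\ C&D\end{bmatrix}:\mathcal X\oplus\mathcal U\to\mathcal X^d\oplus\mathcal Y$ is weakly coisometric if $\mathbf U^*$ is contractive and is isometric on $\mathcal D\oplus\mathcal Y$, where $$\mathcal D=\overline{\operatorname{span}}\{Z(\zeta)^*(I-A^*Z(\zeta)^* )^{-1}C^*y:\ \zeta\in\mathbb B^d,\ y\in\mathcal Y\}\subset\mathcal X^d .$$ *)

(* Defs.v *)
From HB Require Import structures.
From mathcomp Require Import all_boot all_order all_algebra.
From mathcomp Require Import all_classical all_reals all_analysis.
From mathcomp Require Import complex ring.

Set Implicit Arguments.
Unset Strict Implicit.
Unset Printing Implicit Defensive.

Import Order.TTheory GRing.Theory Num.Theory.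
Import numFieldNormedType.Exports.

Local Open Scope classical_set_scope.
Local Open Scope ring_scope.

Section dot_norm.
Variables (C : numClosedFieldType) (U : lmodType C).
Variable form : {dot U for (@Num.conj C)}.
Implicit Types x y : U.

Definition dot_norm x : C := sqrtC (form x x).

Lemma dot_normZ l x : dot_norm (l *: x) = `|l| * dot_norm x.
Proof. by rewrite /dot_norm dnormZ sqrtCM ?nnegrE ?exprn_ge0// sqrCK. Qed.

Lemma dot_norm_eq0 x : dot_norm x = 0 -> x = 0.
Proof. by move/eqP; rewrite sqrt_dnorm_eq0 => /eqP. Qed.

Lemma dot_CauchySchwarz x y : `|form x y| <= dot_norm x * dot_norm y.
Proof.
have [->|y0] := eqVneq y 0.
  by rewrite linear0r normr0 mulr_ge0// sqrt_dnorm_ge0.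
pose a := form x y / form y y.
have yy0 : form y y != 0 by rewrite dnorm_eq0.
rewrite -ler_sqr ?nnegrE ?mulr_ge0 ?sqrt_dnorm_ge0//.
rewrite exprMn !sqrtCK -ler_pdivrMr ?dnorm_gt0//.
have ou : form (x - a *: y) y = 0.
  by rewrite linearBl/= linearZl_LR/= /a divfK// subrr.
have xE : x = (x - a *: y) + a *: y by rewrite subrK.
have -> : form x x = form (x - a *: y) (x - a *: y) + form (a *: y) (a *: y).
  by rewrite -hnormDd ?subrK// linearZr_LR/= ou mulr0.
rewrite dnormZ.
rewrite ler_wpDl ?dnorm_ge0// /a normrM exprMn normfV.
rewrite (ger0_norm (dnorm_ge0 _ _)) expr2 [(form y y)^-1 ^+ 2]expr2.
by rewrite -!mulrA mulVf// mulr1.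
Qed.

Lemma dot_normD x y : dot_norm (x + y) <= dot_norm x + dot_norm y.
Proof.
rewrite -ler_sqr ?nnegrE ?addr_ge0 ?sqrt_dnorm_ge0//.
rewrite sqrrD !sqrtCK dnormD [leRHS]addrAC lerD2l.
rewrite -[_ + _^*](divfK (negbT (pnatr_eq0 C 2))) -ReE -[leRHS]mulr_natr.
rewrite ler_wpM2r//.
have [lexx _] := leif_Re_Creal (form x y).
exact: (le_trans lexx (dot_CauchySchwarz x y)).
Qed.

End dot_norm.

HB.mixin Record NormedModule_isPreHilbert (C : numClosedFieldType) H
    & NormedModule C H := {
  inner : {dot H for (@Num.conj C)};
  inner_norm : forall x : H, inner x x = `|x| ^+ 2
}.

#[short(type="preHilbertType")]
HB.structure Definition PreHilbert (C : numClosedFieldType) :=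
  {H of NormedModule C H & NormedModule_isPreHilbert C H}.

#[short(type="hilbertType")]
HB.structure Definition Hilbert (C : numClosedFieldType) :=
  {H of PreHilbert C H & Complete H}.

Notation "'[ x , y ]" := (inner x y) : ring_scope.

HB.factory Record Lmodule_isPreHilbert (C : numClosedFieldType) H
    & GRing.Lmodule C H := {
  ip : H -> H -> C;
  ip_linearl : forall y, scalar (ip ^~ y);
  ip_conj : forall x y, ip x y = (ip y x)^*;
  ip_gt0 : forall x, x != 0 -> 0 < ip x x
}.

HB.builders Context C H & Lmodule_isPreHilbert C H.

Let ip_bilinear : bilinear_for
  (GRing.Scale.Law.clone _ _ *%R _)
  (GRing.Scale.Law.clone _ _ (Num.conj \; *%R) _) ip.
Proof.
split=> [y|x] a u v; first exact: ip_linearl.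
rewrite ip_conj (ip_linearl x a u v)/= rmorphD rmorphM.
by rewrite (ip_conj x u) (ip_conj x v).
Qed.

HB.instance Definition _ := bilinear_isBilinear.Build C H H C _ _ ip ip_bilinear.

Let ip_hermitian (x y : H) : ip x y = (-1) ^+ false * (ip y x)^*.
Proof. by rewrite expr0 mul1r ip_conj. Qed.

HB.instance Definition _ :=
  isHermitianSesquilinear.Build C H false Num.conj ip ip_hermitian.

HB.instance Definition _ := isDotProduct.Build C H ip ip_gt0.

HB.instance Definition _ := Lmodule_isNormed.Build C H
  (dot_normD ip) (dot_normZ ip) (@dot_norm_eq0 _ _ ip).

Let ip_norm (x : H) : ip x x = `|x| ^+ 2.
Proof. by rewrite sqrtCK. Qed.

HB.instance Definition _ := NormedModule_isPreHilbert.Build C H ip_norm.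

HB.end.

Section inner_theory.
Variables (C : numClosedFieldType) (H : preHilbertType C).
Implicit Types x y z : H.

Lemma innerP z (a : C) x y : '[a *: x + y, z] = a * '[x, z] + '[y, z].
Proof. exact: linearPl. Qed.

Lemma innerC x y : '[x, y] = '[y, x]^*.
Proof. by rewrite hermC expr0 mul1r. Qed.

Lemma innerPr z (a : C) x y : '[z, a *: x + y] = a^* * '[z, x] + '[z, y].
Proof. exact: linearPr. Qed.

Lemma inner_inj x y : (forall z, '[z, x] = '[z, y]) -> x = y.
Proof.
move=> xy; apply/eqP; rewrite -subr_eq0 -normr_eq0 -sqrf_eq0 -inner_norm.
by rewrite linearBr/= xy subrr.
Qed.

Lemma inner_gt0 x : x != 0 -> 0 < '[x, x].
Proof. exact: neq0_dnorm_gt0. Qed.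

Lemma CauchySchwarz_inner x y : `|'[x, y]| <= `|x| * `|y|.
Proof.
have := dot_CauchySchwarz inner x y.
by rewrite /dot_norm !inner_norm !sqrCK.
Qed.

End inner_theory.

(* The aliases [hsum H K] and [hpow H d] below carry the Hilbert (l2) norm,
   unlike the canonical sup norm on products. *)
Section direct_sum.
Variables (C : numClosedFieldType) (H K : hilbertType C).

Definition hsum : Type := (H * K)%type.

HB.instance Definition _ := GRing.Lmodule.on hsum.

Definition hsum_inner (x y : hsum) : C := '[x.1, y.1] + '[x.2, y.2].

Let hsum_linearl y : scalar (hsum_inner ^~ y).
Proof. by move=> a u v; rewrite /hsum_inner !innerP addrACA -mulrDr. Qed.

Let hsum_conj x y : hsum_inner x y = (hsum_inner y x)^*.
Proof.
rewrite /hsum_inner (innerC x.1) (innerC x.2); exact/esym/rmorphD.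
Qed.

Let hsum_gt0 x : x != 0 -> 0 < hsum_inner x x.
Proof.
rewrite /hsum_inner !inner_norm lt_def addr_ge0 ?exprn_ge0// andbT.
rewrite paddr_eq0 ?exprn_ge0// !sqrf_eq0 !normr_eq0 => x0.
by apply: contra x0; case: x => a b /= /andP[/eqP-> /eqP->].
Qed.

HB.instance Definition _ :=
  Lmodule_isPreHilbert.Build C hsum hsum_linearl hsum_conj hsum_gt0.

Lemma hsum_innerE (x y : hsum) : '[x, y] = '[x.1, y.1] + '[x.2, y.2].
Proof. by []. Qed.

Lemma hsum_normE (x : hsum) : `|x| ^+ 2 = `|x.1| ^+ 2 + `|x.2| ^+ 2.
Proof. by rewrite -!inner_norm. Qed.

Lemma hsum_norm_fst (x : hsum) : `|x.1| <= `|x|.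
Proof. by rewrite -ler_sqr ?nnegrE// hsum_normE lerDl exprn_ge0. Qed.

Lemma hsum_norm_snd (x : hsum) : `|x.2| <= `|x|.
Proof. by rewrite -ler_sqr ?nnegrE// hsum_normE lerDr exprn_ge0. Qed.

Lemma hsum_norm_sum (x : hsum) : `|x| <= `|x.1| + `|x.2|.
Proof.
rewrite -ler_sqr ?nnegrE ?addr_ge0// hsum_normE sqrrD.
by rewrite lerD2r lerDl mulrn_wge0// mulr_ge0.
Qed.

Let hsum_complete (F : set_system hsum) : ProperFilter F -> cauchy F -> cvg F.
Proof.
move=> FF /cauchy_ballP Fc.
have F1 : cvg (fst @ F : set_system H).
  apply/cauchy_cvgP/cauchy_ballP => e e0; near_simpl.
  apply: filterS (Fc e e0) => -[x y] /=; rewrite -!ball_normE/=.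
  exact: le_lt_trans (hsum_norm_fst (x - y)).
have F2 : cvg (snd @ F : set_system K).
  apply/cauchy_cvgP/cauchy_ballP => e e0; near_simpl.
  apply: filterS (Fc e e0) => -[x y] /=; rewrite -!ball_normE/=.
  exact: le_lt_trans (hsum_norm_snd (x - y)).
apply/cvg_ex; exists ((lim (fst @ F), lim (snd @ F)) : hsum).
apply/cvgrPdist_lt => e e0.
have e2 : 0 < e / 2 by rewrite divr_gt0.
have FF' : Filter F by case: FF.
have Fl := @cvgr_dist_lt C H _ F FF' fst _ F1 _ e2.
have Fr := @cvgr_dist_lt C K _ F FF' snd _ F2 _ e2.
suff : F [set x | `|(lim (fst @ F), lim (snd @ F)) - x : hsum| < e] by [].
apply: (@filterS2 _ F FF' _ _ _ _ Fl Fr) => x x1 x2.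
by apply: le_lt_trans (hsum_norm_sum _) _; rewrite /= [ltRHS]splitr ltrD.
Qed.

HB.instance Definition _ := Uniform_isComplete.Build hsum hsum_complete.

End direct_sum.

Section power.
Variables (C : numClosedFieldType) (H : hilbertType C) (d : nat).

Definition hpow : Type := {ffun 'I_d -> H}.

HB.instance Definition _ := GRing.Lmodule.on hpow.

Definition hpow_inner (x y : hpow) : C := \sum_(j < d) '[x j, y j].

Let hpow_linearl y : scalar (hpow_inner ^~ y).
Proof.
move=> a u v; rewrite /hpow_inner mulr_sumr -big_split/=.
by apply: eq_bigr => j _; rewrite !ffunE innerP.
Qed.

Let hpow_conj x y : hpow_inner x y = (hpow_inner y x)^*.
Proof.
rewrite /hpow_inner [RHS]rmorph_sum; apply: eq_bigr => j _; exact: innerC.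
Qed.

Let hpow_gt0 x : x != 0 -> 0 < hpow_inner x x.
Proof.
have ge0 (y : H) : 0 <= '[y, y] by rewrite inner_norm exprn_ge0.
move=> x0; rewrite lt_def sumr_ge0// andbT; apply: contra x0.
rewrite psumr_eq0// => /allP x0; apply/eqP/ffunP => j; rewrite !ffunE.
have /= := x0 j (mem_index_enum j).
by rewrite inner_norm sqrf_eq0 normr_eq0 => /eqP.
Qed.

HB.instance Definition _ :=
  Lmodule_isPreHilbert.Build C hpow hpow_linearl hpow_conj hpow_gt0.

Lemma hpow_innerE (x y : hpow) : '[x, y] = \sum_(j < d) '[x j, y j].
Proof. by []. Qed.

Lemma hpow_normE (x : hpow) : `|x| ^+ 2 = \sum_(j < d) `|x j| ^+ 2.
Proof. by rewrite -inner_norm; apply: eq_bigr => j _; rewrite inner_norm. Qed.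

Lemma hpow_norm_coord (x : hpow) j : `|x j| <= `|x|.
Proof.
rewrite -ler_sqr ?nnegrE// hpow_normE (bigD1 j)//= lerDl.
by rewrite sumr_ge0// => i _; rewrite exprn_ge0.
Qed.

Lemma hpow_norm_sum (x : hpow) : `|x| <= \sum_(j < d) `|x j|.
Proof.
rewrite -ler_sqr ?nnegrE ?sumr_ge0// hpow_normE expr2 mulr_suml.
apply: ler_sum => j _; rewrite expr2 ler_wpM2l//.
by rewrite (bigD1 j)//= lerDl sumr_ge0.
Qed.

Let hpow_complete (F : set_system hpow) : ProperFilter F -> cauchy F -> cvg F.
Proof.
move=> FF /cauchy_ballP Fc.
pose p j (x : hpow) : H := x j.
have Fp j : cvg (p j @ F : set_system H).
  apply/cauchy_cvgP/cauchy_ballP => e e0; near_simpl.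
  apply: filterS (Fc e e0) => -[x y] /=; rewrite -!ball_normE/= => xye.
  apply: le_lt_trans xye; have := hpow_norm_coord (x - y) j.
  by rewrite !ffunE.
apply/cvg_ex; exists ([ffun j => lim (p j @ F)] : hpow).
apply/cvgrPdist_lt => e e0.
have ed : 0 < e / d.+1%:R by rewrite divr_gt0.
have FF' : Filter F by case: FF.
have {}Fp j := @cvgr_dist_lt C H _ F FF' (p j) _ (Fp j) _ ed.
have : F [set x | forall j, `|lim (p j @ F) - p j x| < e / d.+1%:R].
  exact: (@filter_forall hpow 'I_d _ F FF' Fp).
move=> Fall.
suff : F [set x | `|([ffun j => lim (p j @ F)] : hpow) - x| < e] by [].
apply: (@filterS hpow F FF' _ _ _ Fall) => x xe.
apply: le_lt_trans (hpow_norm_sum _) _.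
apply: (@le_lt_trans _ _ (\sum_(j < d) (e / d.+1%:R))).
  apply: ler_sum => j _; rewrite !ffunE; exact/ltW/(xe j).
rewrite sumr_const card_ord -mulrnAr -[ltRHS]mulr1 ltr_pM2l//.
by rewrite -[X in X < _]mulr_natl ltr_pdivrMr// mul1r ltr_nat.
Qed.

HB.instance Definition _ := Uniform_isComplete.Build hpow hpow_complete.

End power.

Section bounded_operator.
Variables (C : numClosedFieldType) (H K : hilbertType C).

Record bop := Bop {
  bop_fun :> H -> K;
  bop_linear : linear bop_fun;
  bop_bounded : exists M : C, forall x, `|bop_fun x| <= M * `|x|
}.

HB.instance Definition _ (T : bop) :=
  GRing.isLinear.Build C H K *:%R (bop_fun T) (bop_linear T).

HB.instance Definition _ := gen_eqMixin bop.
HB.instance Definition _ := gen_choiceMixin bop.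

Lemma bop_ext (S T : bop) : S =1 T -> S = T.
Proof.
case: S T => [f lf bf] [g lg bg] /= /funext fg; rewrite fg in lf bf *.
by rewrite (Prop_irrelevance lf lg) (Prop_irrelevance bf bg).
Qed.

Lemma bop_ge0_bounded (T : bop) :
  exists2 M : C, 0 <= M & forall x, `|T x| <= M * `|x|.
Proof.
have [M TM] := bop_bounded T; exists `|M| => // x.
have [->|x0] := eqVneq x 0; first by rewrite linear0 !normr0 mulr0.
have x_gt0 : 0 < `|x| by rewrite normr_gt0.
apply: (le_trans (TM x)); rewrite ler_wpM2r//.
have : 0 <= M * `|x| by apply: le_trans (TM x).
by rewrite pmulr_lge0// => /ger0_norm->.
Qed.

Let bop0_linear : linear (fun _ : H => 0 : K).
Proof. by move=> a x y; rewrite scaler0 addr0. Qed.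

Let bop0_bounded : exists M : C, forall x : H, `|0 : K| <= M * `|x|.
Proof. by exists 0 => x; rewrite normr0 mul0r. Qed.

Definition bop0 := Bop bop0_linear bop0_bounded.

Let bopD_linear (S T : bop) : linear (fun x => S x + T x).
Proof. by move=> a x y; rewrite !linearP scalerDr addrACA. Qed.

Let bopD_bounded (S T : bop) :
  exists M : C, forall x, `|S x + T x| <= M * `|x|.
Proof.
have [M SM] := bop_bounded S; have [N TN] := bop_bounded T.
by exists (M + N) => x; rewrite mulrDl (le_trans (ler_normD _ _)) ?lerD.
Qed.

Definition bopD (S T : bop) := Bop (bopD_linear S T) (bopD_bounded S T).

Let bopZ_linear a (T : bop) : linear (fun x => a *: T x).
Proof. by move=> b x y; rewrite linearP scalerDr !scalerA mulrC. Qed.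

Let bopZ_bounded a (T : bop) : exists M : C, forall x, `|a *: T x| <= M * `|x|.
Proof.
have [M TM] := bop_bounded T.
by exists (`|a| * M) => x; rewrite normrZ -mulrA ler_wpM2l.
Qed.

Definition bopZ a (T : bop) := Bop (bopZ_linear a T) (bopZ_bounded a T).

Let bopDA : associative bopD.
Proof. by move=> S T U; apply: bop_ext => x /=; rewrite addrA. Qed.

Let bopDC : commutative bopD.
Proof. by move=> S T; apply: bop_ext => x /=; rewrite addrC. Qed.

Let bop0D : left_id bop0 bopD.
Proof. by move=> T; apply: bop_ext => x /=; rewrite add0r. Qed.

Let bopND : left_inverse bop0 (bopZ (-1)) bopD.
Proof. by move=> T; apply: bop_ext => x /=; rewrite scaleN1r addNr. Qed.

HB.instance Definition _ := GRing.isZmodule.Build bop bopDA bopDC bop0D bopND.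

Let bopZA a b (T : bop) : bopZ a (bopZ b T) = bopZ (a * b) T.
Proof. by apply: bop_ext => x /=; rewrite scalerA. Qed.

Let bop1Z : left_id 1 bopZ.
Proof. by move=> T; apply: bop_ext => x /=; rewrite scale1r. Qed.

Let bopZDr : right_distributive bopZ +%R.
Proof. by move=> a S T; apply: bop_ext => x /=; rewrite scalerDr. Qed.

Let bopZDl (T : bop) : {morph bopZ^~ T : a b / a + b}.
Proof. by move=> a b; apply: bop_ext => x /=; rewrite scalerDl. Qed.

HB.instance Definition _ :=
  GRing.Zmodule_isLmodule.Build C bop bopZA bop1Z bopZDr bopZDl.

Lemma bopDE (S T : bop) x : (S + T) x = S x + T x. Proof. by []. Qed.

Lemma bopNE (T : bop) x : (- T) x = - T x.
Proof. exact: scaleN1r. Qed.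

Lemma bopBE (S T : bop) x : (S - T) x = S x - T x.
Proof. by rewrite bopDE bopNE. Qed.

Lemma bopZE a (T : bop) x : (a *: T) x = a *: T x. Proof. by []. Qed.

Lemma bop_sumE I r (P : pred I) (T : I -> bop) x :
  (\sum_(i <- r | P i) T i) x = \sum_(i <- r | P i) T i x.
Proof. exact: (big_morph (fun S : bop => S x) (fun _ _ => erefl) erefl). Qed.

Definition contractive (T : bop) := forall x, `|T x| <= `|x|.

Definition isometric_on (M : set H) (T : bop) := forall x, M x -> `|T x| = `|x|.

Definition opnorm_le (T : bop) (c : C) := forall x, `|T x| <= c * `|x|.

End bounded_operator.

Notation "{ 'bounded' H -> K }" := (bop H K)
  (at level 0, H at level 98, K at level 99, format "{ 'bounded'  H  ->  K }")
  : type_scope.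

Section bop_composition.
Variables (C : numClosedFieldType) (H K L : hilbertType C).

Let bop_id_linear : linear (@id H). Proof. by []. Qed.

Let bop_id_bounded : exists M : C, forall x : H, `|x| <= M * `|x|.
Proof. by exists 1 => x; rewrite mul1r. Qed.

Definition bop_id : {bounded H -> H} := Bop bop_id_linear bop_id_bounded.

Variables (S : {bounded K -> L}) (T : {bounded H -> K}).

Let bop_comp_linear : linear (S \o T).
Proof. by move=> a x y /=; rewrite !linearP. Qed.

Let bop_comp_bounded : exists M : C, forall x, `|S (T x)| <= M * `|x|.
Proof.
have [M M0 SM] := bop_ge0_bounded S; have [N TN] := bop_bounded T.
exists (M * N) => x; apply: (le_trans (SM _)).
by rewrite -mulrA ler_wpM2l.
Qed.

Definition bop_comp : {bounded H -> L} := Bop bop_comp_linear bop_comp_bounded.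

End bop_composition.
Arguments bop_id {C H}.


Declare Scope bop_scope.
Delimit Scope bop_scope with BO.
Notation "S \o T" := (bop_comp S T) : bop_scope.

Section block_operators.
Variables (C : numClosedFieldType) (d : nat).

Section column.
Variables (H K : hilbertType C) (T : 'I_d -> {bounded H -> K}).

Let col_fun (x : H) : hpow K d := [ffun j => T j x].

Let col_linear : linear col_fun.
Proof.
by move=> a x y; apply/ffunP => j; rewrite !ffunE linearP.
Qed.

Let col_bounded : exists M : C, forall x, `|col_fun x| <= M * `|x|.
Proof.
have TM j : {M : C | 0 <= M & forall x, `|T j x| <= M * `|x|}.
  exact/cid2/bop_ge0_bounded.
pose M j := s2val (TM j).
have M0 j : 0 <= M j := s2valP (TM j).
exists (\sum_(j < d) M j) => x; rewrite mulr_suml.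
rewrite (le_trans (hpow_norm_sum _))//; apply: ler_sum => j _.
by rewrite ffunE; exact: (s2valP' (TM j)).
Qed.

Definition column : {bounded H -> hpow K d} := Bop col_linear col_bounded.

Lemma columnE x j : column x j = T j x. Proof. by rewrite ffunE. Qed.

End column.

Section row.
Variable (H : hilbertType C) (l : 'rV[C]_d).

Let row_fun (x : hpow H d) : H := \sum_(j < d) l 0 j *: x j.

Let row_linear : linear row_fun.
Proof.
move=> a x y; rewrite scaler_sumr -big_split/=; apply: eq_bigr => j _.
by rewrite !ffunE scalerDr !scalerA mulrC.
Qed.

Let row_bounded : exists M : C, forall x, `|row_fun x| <= M * `|x|.
Proof.
exists (\sum_(j < d) `|l 0 j|) => x; rewrite mulr_suml.
rewrite (le_trans (ler_norm_sum _ _ _))//; apply: ler_sum => j _.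
by rewrite normrZ ler_wpM2l// hpow_norm_coord.
Qed.

Definition Zrow : {bounded hpow H d -> H} := Bop row_linear row_bounded.

End row.

Section block.
Variables (H1 H2 K1 K2 : hilbertType C).
Variables (T11 : {bounded H1 -> K1}) (T12 : {bounded H2 -> K1}).
Variables (T21 : {bounded H1 -> K2}) (T22 : {bounded H2 -> K2}).

Let block_fun (x : hsum H1 H2) : hsum K1 K2 :=
  (T11 x.1 + T12 x.2, T21 x.1 + T22 x.2).

Let block_linear : linear block_fun.
Proof.
by move=> a x y; congr (_, _); rewrite /= !linearP scalerDr addrACA.
Qed.

Let block_bounded : exists M : C, forall x, `|block_fun x| <= M * `|x|.
Proof.
have [M1 M10 TM1] := bop_ge0_bounded T11; have [M2 M20 TM2] := bop_ge0_bounded T12.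
have [M3 M30 TM3] := bop_ge0_bounded T21; have [M4 M40 TM4] := bop_ge0_bounded T22.
exists ((M1 + M2) + (M3 + M4)) => x.
rewrite (le_trans (hsum_norm_sum _))// [leRHS]mulrDl.
have le1 := hsum_norm_fst x; have le2 := hsum_norm_snd x.
apply: lerD; rewrite mulrDl (le_trans (ler_normD _ _))//; apply: lerD.
- by rewrite (le_trans (TM1 _))// ler_wpM2l.
- by rewrite (le_trans (TM2 _))// ler_wpM2l.
- by rewrite (le_trans (TM3 _))// ler_wpM2l.
- by rewrite (le_trans (TM4 _))// ler_wpM2l.
Qed.

Definition block_op : {bounded hsum H1 H2 -> hsum K1 K2} :=
  Bop block_linear block_bounded.

End block.
End block_operators.

Section riesz.
Variables (R : realType) (H : hilbertType R[i]).
Variable phi : H -> R[i].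
Hypothesis phi_linear : scalar phi.
Hypothesis phi_bounded : exists M, forall x, `|phi x| <= M * `|x|.

Let phiD x y : phi (x + y) = phi x + phi y.
Proof. by have := phi_linear 1 x y; rewrite scale1r mul1r. Qed.

Let phi0 : phi 0 = 0.
Proof. by apply: (addIr (phi 0)); rewrite -phiD !addr0 add0r. Qed.

Let phiZ a x : phi (a *: x) = a * phi x.
Proof. by have := phi_linear a x 0; rewrite !addr0 phi0 addr0. Qed.

Let energy x : R[i] := `|x| ^+ 2 - (phi x + (phi x)^*).

Let energyE x : energy x = (complex.Re (energy x))%:C%C.
Proof.
suff /complex_realP[k ->] : energy x \is Num.real by [].
rewrite /energy rpredB ?rpredX ?normr_real//.
by rewrite CrealE rmorphD/= conjCK addrC.
Qed.

Let energy_line x y : x != 0 -> let w := '[x, y] - phi x in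
  energy (y - (w^* / `|x| ^+ 2) *: x) = energy y - `|w| ^+ 2 / `|x| ^+ 2.
Proof.
move=> x0 w.
have x2 : `|x| ^+ 2 != 0 by rewrite sqrf_eq0 normr_eq0.
have x2c : (`|x| ^+ 2)^* = `|x| ^+ 2 by apply/CrealP; rewrite rpredX ?normr_real.
set a := - (w^* / `|x| ^+ 2).
have aw : a * w = - (`|w| ^+ 2 / `|x| ^+ 2).
  by rewrite /a normCKC mulNr mulrAC.
have awc : (a * w)^* = a * w.
  by apply/CrealP; rewrite aw rpredN rpred_div// rpredX ?normr_real.
have a2 : `|a| ^+ 2 * `|x| ^+ 2 = `|w| ^+ 2 / `|x| ^+ 2.
  rewrite /a normrN normf_div norm_conjC.
  rewrite (ger0_norm (exprn_ge0 2 (normr_ge0 x))).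
  by move: (`|x| ^+ 2) x2 => q q0; field.
rewrite -scaleNr -/a /energy.
have yax : '[y, a *: x] = (a * '[x, y])^*.
  by rewrite innerC -[a *: x]addr0 innerP linear0l addr0.
rewrite -[in LHS]inner_norm dnormD dnormZ !inner_norm a2 phiD phiZ yax.
have -> : a * '[x, y] = a * w + a * phi x by rewrite /w mulrBr subrK.
rewrite !rmorphD/= !awc aw.
move: (`|w| ^+ 2 / `|x| ^+ 2) => p.
have -> : (a * phi x)^*^* = a * phi x by exact: conjCK.
move: ((a * phi x)^*) ((phi y)^*) (a * phi x) => q' r' q.
by ring.
Qed.

Let energy_bounded : exists m : R, forall x, m <= complex.Re (energy x).
Proof.
have [M phiM] := phi_bounded; exists (- complex.Re (`|M| ^+ 2)) => x.
have M2 : `|M| ^+ 2 = (complex.Re (`|M| ^+ 2))%:C%C.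
  have /complex_realP[k ->] // : `|M| ^+ 2 \is Num.real.
  by rewrite rpredX ?normr_real.
rewrite -lecR -energyE rmorphN/= -M2 /energy.
have phix : phi x + (phi x)^* <= 2 * (`|M| * `|x|).
  rewrite -[leLHS](divfK (negbT (pnatr_eq0 _ 2))) -ReE mulrC ler_wpM2l//.
  have [phi1 _] := leif_Re_Creal (phi x); apply: (le_trans phi1).
  apply: le_trans (phiM x) _.
  have [->|x0] := eqVneq x 0; first by rewrite !normr0 !mulr0.
  have x_gt0 : 0 < `|x| by rewrite normr_gt0.
  have : 0 <= M * `|x| by apply: le_trans (phiM x).
  by rewrite pmulr_lge0// => /ger0_norm->.
rewrite lerBrDr (le_trans (lerD (lexx _) phix))// -subr_ge0.
have -> : `|x| ^+ 2 - (- `|M| ^+ 2 + 2 * (`|M| * `|x|)) = (`|x| - `|M|) ^+ 2.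
  by ring.
by rewrite real_exprn_even_ge0// rpredB ?normr_real.
Qed.

Let m : R := inf (range (fun x => complex.Re (energy x))).

Let energy_inf x : m%:C%C <= energy x.
Proof.
have [k kP] := energy_bounded.
rewrite energyE lecR; apply: ge_inf; last by exists x.
by exists k => _ [y _ <-]; exact: kP.
Qed.

Let almost_rep (e : R[i]) :=
  [set y : H | forall x, `|'[x, y] - phi x| <= `|x| * e].

Let almost_rep_nonempty e : 0 < e -> almost_rep e !=set0.
Proof.
move=> e0.
have e2 : e ^+ 2 = (complex.Re (e ^+ 2))%:C%C.
  suff /complex_realP[k ->] : e ^+ 2 \is Num.real by [].
  by rewrite rpredX// gtr0_real.
have e2_gt0 : 0 < complex.Re (e ^+ 2) by rewrite -ltcR -e2 exprn_gt0.
have hi : has_inf (range (fun x => complex.Re (energy x))).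
  split; first by exists (complex.Re (energy 0)), 0.
  by have [k kP] := energy_bounded; exists k => _ [y _ <-]; exact: kP.
have [_ [y _ <-]/= ylt] := inf_adherent e2_gt0 hi.
exists y => x; have [->|x0] := eqVneq x 0.
  by rewrite linear0l phi0 subr0 !normr0 mul0r.
have le0 : 0 <= `|x| * e by rewrite mulr_ge0// ltW.
rewrite -ler_sqr ?nnegrE// exprMn mulrC.
rewrite -ler_pdivrMr ?exprn_gt0 ?normr_gt0//.
have := energy_inf (y - (('[x, y] - phi x)^* / `|x| ^+ 2) *: x).
rewrite energy_line// lerBrDr -lerBrDl => /le_trans; apply.
rewrite lerBlDl energyE e2 -rmorphD lecR; exact: ltW.
Qed.

Lemma riesz_representation : exists z, forall x, phi x = '[x, z].
Proof.
pose F := filter_from [set e : R[i] | 0 < e] almost_rep.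
have FF : Filter F.
  apply: filter_from_filter; first by exists 1; exact: ltr01.
  move=> e e' /= e0 e'0; have [le|le] := orP (real_leVge (gtr0_real e0) (gtr0_real e'0)).
    exists e => //= y ye; split=> // x; apply: le_trans (ye x) _.
    by rewrite ler_wpM2l.
  exists e' => //= y ye; split=> // x; apply: le_trans (ye x) _.
  by rewrite ler_wpM2l.
have PF : ProperFilter F.
  by apply: filter_from_proper => e e0; exact: almost_rep_nonempty.
have Fc : cauchy F.
  apply/cauchy_ballP => e e0.
  have e3 : 0 < e / 3 by rewrite divr_gt0.
  exists (almost_rep (e / 3), almost_rep (e / 3)).
    by split; exists (e / 3).
  move=> [y y'] [/= ye y'e]; rewrite -ball_normE/=.
  have [->|yy'] := eqVneq y y'; first by rewrite subrr normr0.
  set x := y - y'.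
  have x_gt0 : 0 < `|x| by rewrite normr_gt0 subr_eq0.
  apply: (@le_lt_trans _ _ (e / 3 + e / 3)).
    rewrite -(ler_pM2l x_gt0) -expr2 -inner_norm mulrDr.
    have -> : '[x, x] = ('[x, y] - phi x) - ('[x, y'] - phi x).
      by rewrite {2}/x linearBr/= opprB addrA subrK.
    rewrite -[leLHS]ger0_norm.
      exact: le_trans (ler_normB _ _) (lerD (ye x) (y'e x)).
    have -> : '[x, y] - phi x - ('[x, y'] - phi x) = '[x, x].
      by rewrite {4}/x linearBr/= opprB addrA subrK.
    by rewrite inner_norm exprn_ge0.
  rewrite -subr_gt0; have -> : e - (e / 3 + e / 3) = e / 3 by field.
  exact: e3.
have Fl : F --> lim F by exact: cauchy_cvg.
exists (lim F) => x; set z := lim F in Fl *.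
apply/esym/eqP; rewrite -subr_eq0 -normr_eq0; apply/negPn/negP => c0.
set c := `|_| in c0; have c_gt0 : 0 < c by rewrite lt_def c0 normr_ge0.
have x1_gt0 : 0 < `|x| + 1 by rewrite ltr_wpDl.
pose e := c / (2 * (`|x| + 1)).
have e_gt0 : 0 < e by rewrite divr_gt0// mulr_gt0.
have [y [zy ye]] : (ball z e `&` almost_rep e) !=set0.
  apply: (@filter_ex _ F PF); apply: filterI; last by exists e.
  exact: Fl (nbhsx_ballx z e e_gt0).
rewrite -ball_normE/= in zy.
suff : c < c by rewrite ltxx.
have cE : c = e * (2 * (`|x| + 1)).
  by rewrite /e divfK// mulf_neq0 ?pnatr_eq0// gt_eqF.
apply: (@le_lt_trans _ _ (`|x| * e + `|x| * e)).
  have -> : c = `|'[x, z - y] + ('[x, y] - phi x)|.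
    by rewrite linearBr/= addrA subrK.
  apply: le_trans (ler_normD _ _) (lerD _ (ye x)).
  by apply: le_trans (CauchySchwarz_inner _ _) _; rewrite ler_wpM2l// ltW.
rewrite [ltRHS]cE -subr_gt0.
have -> : e * (2 * (`|x| + 1)) - (`|x| * e + `|x| * e) = 2 * e.
  by move: `|x| => n; ring.
by rewrite mulr_gt0.
Qed.

End riesz.

Section adjoint.
Variables (R : realType) (H K : hilbertType R[i]) (T : {bounded H -> K}).

Let adj_ex y : exists z, forall x, '[T x, y] = '[x, z].
Proof.
apply: riesz_representation.
  by move=> a u v; rewrite linearP innerP.
have [M TM] := bop_bounded T; exists (M * `|y|) => x.
apply: le_trans (CauchySchwarz_inner _ _) _.
by rewrite [leRHS]mulrAC ler_wpM2r ?normr_ge0 ?TM.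
Qed.

Let adj_fun y : H := projT1 (cid (adj_ex y)).

Let adj_funP x y : '[T x, y] = '[x, adj_fun y].
Proof. by rewrite /adj_fun; case: cid. Qed.

Let adj_linear : linear adj_fun.
Proof.
move=> a y y'; apply: inner_inj => x.
by rewrite -adj_funP !innerPr -!adj_funP.
Qed.

Let adj_bounded : exists M, forall y, `|adj_fun y| <= M * `|y|.
Proof.
have [M M0 TM] := bop_ge0_bounded T; exists M => y.
have [->|z0] := eqVneq (adj_fun y) 0; first by rewrite normr0 mulr_ge0.
have z_gt0 : 0 < `|adj_fun y| by rewrite normr_gt0.
rewrite -(ler_pM2l z_gt0) -expr2 -inner_norm -adj_funP.
rewrite -[leLHS]ger0_norm; last by rewrite adj_funP inner_norm exprn_ge0.
apply: le_trans (CauchySchwarz_inner _ _) _.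
by rewrite mulrCA mulrA ler_wpM2r.
Qed.

Definition adjoint : {bounded K -> H} := Bop adj_linear adj_bounded.

Lemma adjointP x y : '[T x, y] = '[x, adjoint y].
Proof. exact: adj_funP. Qed.

End adjoint.

Section inverse.
Variables (C : numClosedFieldType) (H : hilbertType C).

Definition is_inverse (T T' : {bounded H -> H}) :=
  (T' \o T)%BO = bop_id /\ (T \o T')%BO = bop_id.

Definition invertible (T : {bounded H -> H}) := exists T', is_inverse T T'.

(* The bounded two-sided inverse of [T]; it is 0 when [T] is not invertible. *)
Definition bop_inv (T : {bounded H -> H}) : {bounded H -> H} :=
  xget 0 [set T' | is_inverse T T'].

Lemma bop_invP (T : {bounded H -> H}) : invertible T -> is_inverse T (bop_inv T).
Proof. by move=> [T' TT']; exact: (@xgetI _ 0 [set T' | is_inverse T T'] T'). Qed.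

Lemma bop_inv_eq (T T' : {bounded H -> H}) : is_inverse T T' -> bop_inv T = T'.
Proof.
move=> [T'T TT']; have [VT TV] := bop_invP (ex_intro _ T' (conj T'T TT')).
apply: bop_ext => x; have := congr1 (fun S : {bounded H -> H} => S x) TT'.
move=> /= {1}<-; have := congr1 (fun S : {bounded H -> H} => S (T' x)) VT.
by move=> /= ->.
Qed.

End inverse.

Section span.
Variables (C : numClosedFieldType) (V : lmodType C).

Definition lspan (A : set V) : set V :=
  [set v | exists n (c : 'I_n -> C) (a : 'I_n -> V),
     (forall i, A (a i)) /\ v = \sum_(i < n) c i *: a i].

End span.

(* [HTensor] presents a Hilbert space as the completed tensor product of [H]
   and [K]: elementary tensors have the product inner product and are total. *)
Record hilbert_tensor (C : numClosedFieldType) (H K : hilbertType C) := HTensor {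
  tensor_space :> hilbertType C;
  tensor : H -> K -> tensor_space;
  tensor_linearl : forall y, linear (tensor ^~ y);
  tensor_linearr : forall x, linear (tensor x);
  tensor_inner : forall x x' y y',
    '[tensor x y, tensor x' y'] = '[x, x'] * '[y, y'];
  tensor_total :
    closure (lspan [set tensor x y | x in [set: H] & y in [set: K]]) =
    [set: tensor_space]
}.

(* A reproducing kernel Hilbert space of functions on [T] is a Hilbert space
   whose elements are identified with functions by an injective linear
   evaluation map. It is determined by its kernel up to the unique unitary map
   compatible with evaluation. *)
Record scalar_rkhs (C : numClosedFieldType) (T : Type) (k : T -> T -> C) :=
  ScalarRkhs {
  srkhs_space :> hilbertType C;
  srkhs_eval : srkhs_space -> T -> C;
  srkhs_eval_linear : forall t, scalar (srkhs_eval ^~ t);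
  srkhs_eval_inj : injective srkhs_eval;
  srkhs_kernel : T -> srkhs_space;
  srkhs_kernelE : forall s t, srkhs_eval (srkhs_kernel t) s = k s t;
  srkhs_reproducing : forall f t, '[f, srkhs_kernel t] = srkhs_eval f t
}.

Record rkhs (C : numClosedFieldType) (T : Type) (Y : hilbertType C)
    (K : T -> T -> {bounded Y -> Y}) := Rkhs {
  rkhs_space :> hilbertType C;
  rkhs_eval : rkhs_space -> T -> Y;
  rkhs_eval_linear : forall t, linear (rkhs_eval ^~ t);
  rkhs_eval_inj : injective rkhs_eval;
  rkhs_kernel : T -> Y -> rkhs_space;
  rkhs_kernelE : forall s t y, rkhs_eval (rkhs_kernel t y) s = K s t y;
  rkhs_reproducing : forall f t y, '[f, rkhs_kernel t y] = '[rkhs_eval f t, y]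
}.

(* The tensor product of a scalar reproducing kernel Hilbert space with [Y],
   viewed as a space of [Y]-valued functions: evaluation at [t] is the bounded
   extension of [f (x) y |-> f t *: y]. *)
Record vector_rkhs (C : numClosedFieldType) (T : Type) (k : T -> T -> C)
    (H : scalar_rkhs k) (Y : hilbertType C) := VectorRkhs {
  vrkhs_space :> hilbert_tensor H Y;
  vrkhs_eval : vrkhs_space -> T -> Y;
  vrkhs_eval_linear : forall t, linear (vrkhs_eval ^~ t);
  vrkhs_eval_bounded :
    forall t, exists M : C, forall F, `|vrkhs_eval F t| <= M * `|F|;
  vrkhs_eval_tensor : forall f y t,
    vrkhs_eval (tensor vrkhs_space f y) t = srkhs_eval f t *: y
}.

Section ball.
Variables (R : realType) (d : nat).

Definition cdot (z w : 'rV[R[i]]_d) : R[i] := \sum_(j < d) z 0 j * (w 0 j)^*.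

Definition ball_d := {z : 'rV[R[i]]_d | cdot z z < 1}.

Definition ball_coord (z : ball_d) : 'rV[R[i]]_d := sval z.

Lemma ball_origin_proof : cdot 0 0 < 1.
Proof. by rewrite /cdot big1 ?ltr01// => j _; rewrite mxE mul0r. Qed.

Definition ball_origin : ball_d := exist _ 0 ball_origin_proof.

End ball.
Arguments ball_origin {R d}.
Coercion ball_coord : ball_d >-> matrix.

Section schur_class.
Variables (R : realType) (d : nat).
Local Notation B := (ball_d R d).

Definition kd (l z : B) : R[i] := (1 - cdot l z)^-1.

Variables (U Y : hilbertType R[i]).

(* Analyticity of an operator-valued function: complex Frechet
   differentiability, in operator norm, at every point of the ball. *)
Definition analytic (S : B -> {bounded U -> Y}) :=
  forall l : B, exists DS : 'I_d -> {bounded U -> Y},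
    forall e : R[i], 0 < e -> exists2 r : R[i], 0 < r &
      forall z : B, `|ball_coord z - ball_coord l| < r ->
        opnorm_le (S z - S l - \sum_(j < d) (z 0 j - l 0 j) *: DS j)
                  (e * `|ball_coord z - ball_coord l|).

Definition contractive_multiplier (Hk : scalar_rkhs kd)
    (HU : vector_rkhs Hk U) (HY : vector_rkhs Hk Y) (S : B -> {bounded U -> Y}) :=
  forall f : HU, exists2 g : HY,
    (forall l : B, vrkhs_eval g l = S l (vrkhs_eval f l)) & `|g| <= `|f|.

Definition schur_class (Hk : scalar_rkhs kd)
    (HU : vector_rkhs Hk U) (HY : vector_rkhs Hk Y) (S : B -> {bounded U -> Y}) :=
  analytic S /\ contractive_multiplier HU HY S.

Definition KS (S : B -> {bounded U -> Y}) (l z : B) : {bounded Y -> Y} :=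
  (1 - cdot l z)^-1 *: (bop_id - (S l \o adjoint (S z))%BO).

End schur_class.

Section realization.
Variables (R : realType) (d : nat) (U Y X : hilbertType R[i]).
Local Notation B := (ball_d R d).
Variables (A : 'I_d -> {bounded X -> X}) (Bcol : 'I_d -> {bounded U -> X}).
Variables (Cop : {bounded X -> Y}) (D : {bounded U -> Y}).

Definition connecting_op : {bounded hsum X U -> hsum (hpow X d) Y} :=
  block_op (column A) (column Bcol) Cop D.

Definition realizes (S : B -> {bounded U -> Y}) := forall l : B,
  invertible (bop_id - (Zrow X l \o column A)%BO) /\
  S l = D + (Cop \o bop_inv (bop_id - (Zrow X l \o column A)) \o
             Zrow X l \o column Bcol)%BO.

(* Below [bop_inv] is a genuine inverse as soon as the connecting operator is a
   contraction, which [weakly_coisometric] requires separately. *)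
Definition weak_domain : set (hpow X d) :=
  closure (lspan [set v | exists (z : B) (y : Y),
    v = adjoint (Zrow X z)
          (bop_inv (bop_id - (adjoint (column A) \o adjoint (Zrow X z))%BO)
            (adjoint Cop y))]).

Definition weakly_coisometric :=
  contractive (adjoint connecting_op) /\
  isometric_on [set v : hsum (hpow X d) Y | weak_domain v.1] (adjoint connecting_op).

End realization.

(* Main.v *)
Require Import Defs.
From mathcomp Require Import all_boot all_order all_algebra.
From mathcomp Require Import all_classical all_reals all_analysis.
From mathcomp Require Import complex ring.

Set Implicit Arguments.
Unset Strict Implicit.
Unset Printing Implicit Defensive.

Import Order.TTheory GRing.Theory Num.Theory.
Import numFieldNormedType.Exports.

Local Open Scope classical_set_scope.
Local Open Scope ring_scope.

(** Write k_z y for the kernel functions of H = H(K_S).  The formula for K_S says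
    exactly that (Z(z)^* k_z y, y) |-> (k_z y, S(z)^* y) preserves inner products
    from H^d (+) Y to H (+) U (the lurking isometry); let E be the span of its
    graph.  Condition (i) on the state operators A is dual to
    [A^* C^*] (Z(z)^* k_z y, y) = k_z y, and (ii) says that [A^* C^*] is a
    contraction.

    (1) The Riesz theorem on the range of the first component of E produces the
    adjoint f |-> (A f, f(0)) of the first component of the isometry.

    (2) Let Q = [A^* C^*].  The second row W = [B^* D^*] is forced on the first
    component of E, where it is isometric for the semi-inner product
    q(g, h) = <g, h> - <Q g, Q h>; extending it by 0 need not keep
    (Q, W) contractive.  Instead W g is the vector representing
    W v |-> q(v, g); then |W g|^2 <= q(g, g) on all of H^d (+) Y.  The transfer
    function formula follows by evaluating (I - Z(l) A) x = Z(l) B u at l and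
    using (i). *)

(** * Expansion of inner products and squared norms *)

Section inner_expansion.
Variables (C : numClosedFieldType) (H : preHilbertType C).
Implicit Types x y z : H.

Lemma inner0l x : '[0, x] = 0. Proof. exact: linear0l. Qed.
Lemma inner0r x : '[x, 0] = 0. Proof. exact: linear0r. Qed.
Lemma innerDl x y z : '[x + y, z] = '[x, z] + '[y, z].
Proof. exact: linearDl. Qed.
Lemma innerDr x y z : '[z, x + y] = '[z, x] + '[z, y].
Proof. exact: linearD. Qed.
Lemma innerBl x y z : '[x - y, z] = '[x, z] - '[y, z].
Proof. exact: linearBl. Qed.
Lemma innerBr x y z : '[z, x - y] = '[z, x] - '[z, y].
Proof. exact: linearB. Qed.
Lemma innerZl a x y : '[a *: x, y] = a * '[x, y].
Proof. by have := innerP y a x 0; rewrite addr0 inner0l addr0. Qed.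
Lemma innerZr a x y : '[x, a *: y] = a^* * '[x, y].
Proof. by have := innerPr x a y 0; rewrite addr0 inner0r addr0. Qed.

Lemma inner_suml I r (P : pred I) (F : I -> H) y :
  '[\sum_(i <- r | P i) F i, y] = \sum_(i <- r | P i) '[F i, y].
Proof.
by apply: (big_morph (fun x => '[x, y]) (fun _ _ => innerDl _ _ _)); exact: inner0l.
Qed.

Lemma inner_injl x y : (forall z, '[x, z] = '[y, z]) -> x = y.
Proof. by move=> xy; apply: inner_inj => z; rewrite innerC xy -innerC. Qed.

Lemma sqr_normD x y :
  `|x + y| ^+ 2 = `|x| ^+ 2 + `|y| ^+ 2 + ('[x, y] + '[x, y]^*).
Proof. by rewrite -inner_norm dnormD !inner_norm. Qed.

Lemma sqr_normB x y :
  `|x - y| ^+ 2 = `|x| ^+ 2 + `|y| ^+ 2 - ('[x, y] + '[x, y]^*).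
Proof.
rewrite sqr_normD normrN -scaleN1r innerZr rmorphM/= rmorphN rmorph1 conjCN1.
ring.
Qed.

End inner_expansion.

(** * Infima, limits and small-parameter estimates over a partially ordered field *)

Section complex_order.
Variable R : realType.

(** Anything comparable with a real number is real, so [A] lies on the real axis and its infimum is
    that of the real parts. *)
Lemma complex_infimum (A : set R[i]) (b : R[i]) :
  A !=set0 -> b \is Num.real -> (forall x, A x -> b <= x) ->
  exists m, (forall x, A x -> m <= x) /\
            (forall e, 0 < e -> exists2 x, A x & x < m + e).
Proof.
move=> [a Aa] /complex_realP[b' ->] bA.
have AE x : A x -> x = (complex.Re x)%:C%C.
  move=> /bA bx; have : x \is Num.real by rewrite -(ler_real bx) complex_real.
  by move=> /complex_realP[x' ->].
have hi : has_inf (@complex.Re R @` A).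
  split; first by exists (complex.Re a), a.
  by exists b' => _ [x Ax <-]; rewrite -lecR -AE// bA.
exists (inf (@complex.Re R @` A))%:C%C; split=> [x Ax|e e0].
  by rewrite (AE x Ax) lecR; apply: ge_inf; [case: hi | exists x].
have /complex_realP[e' eE] : e \is Num.real by rewrite gtr0_real.
move: e0; rewrite eE ltcR => e'0.
have [_ [x Ax <-] xe] := inf_adherent e'0 hi.
by exists x => //; rewrite (AE x Ax) -rmorphD ltcR.
Qed.

End complex_order.

(** The nested sets [A e] generate a filter, Cauchy because their diameters are at most [k * e]; [h]
    is its limit. *)
Lemma cauchy_family_limit (R : realType) (G : hilbertType R[i])
    (A : R[i] -> set G) (k : R[i]) :
  0 < k ->
  (forall e, 0 < e -> A e !=set0) ->
  (forall e e', 0 < e -> e <= e' -> A e `<=` A e') ->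
  (forall e x y, 0 < e -> A e x -> A e y -> `|x - y| <= k * e) ->
  exists h, forall e, 0 < e -> exists2 x, A e x & `|x - h| < e.
Proof.
move=> k0 A0 Amono Asmall.
pose F := filter_from [set e : R[i] | 0 < e] A.
have FF : Filter F.
  apply: filter_from_filter; first by exists 1; exact: ltr01.
  move=> e e' /= e0 e'0.
  have [le|le] := orP (real_leVge (gtr0_real e0) (gtr0_real e'0)).
    by exists e => //= y ye; split=> //; exact: Amono ye.
  by exists e' => //= y ye; split=> //; exact: Amono ye.
have PF : ProperFilter F by apply: filter_from_proper.
have Fc : cauchy F.
  apply/cauchy_ballP => e e0.
  have ek : 0 < e / (2 * k) by rewrite divr_gt0// mulr_gt0.
  exists (A (e / (2 * k)), A (e / (2 * k))); first by split; exists (e / (2 * k)).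
  move=> [y y'] [/= ye y'e]; rewrite -ball_normE/=.
  apply: le_lt_trans (Asmall _ _ _ ek ye y'e) _.
  have -> : k * (e / (2 * k)) = e / 2 by field; rewrite gt_eqF.
  by rewrite ltr_pdivrMr// mulr_natr mulr2n ltrDl.
have Fl : F --> lim F by exact: cauchy_cvg.
exists (lim F) => e e0.
have [y [hy ye]] : (ball (lim F) e `&` A e) !=set0.
  apply: (@filter_ex _ F PF); apply: filterI; last by exists e.
  exact: Fl (nbhsx_ballx _ e e0).
by exists y => //; rewrite distrC; move: hy; rewrite -ball_normE.
Qed.

Section numeric_bounds.
Variable C : numClosedFieldType.
Implicit Types z p q k : C.

Lemma addCconj_le z : z + z^* <= 2 * `|z|.
Proof.
rewrite -[leLHS](divfK (negbT (pnatr_eq0 C 2))) -ReE mulrC ler_wpM2l//.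
by have [] := leif_Re_Creal z.
Qed.

(** Replaces letting [e] tend to 0. As the order is partial, the case [e = 1] first shows that
    [p - q] is real and so comparable with 0. *)
Lemma ler_quadratic_eps k p q : 0 <= k ->
  (forall e, 0 < e -> p <= q + e * (e + k)) -> p <= q.
Proof.
move=> k0 pq; have k1 : 0 < 1 + k by rewrite ltr_pwDl.
have pqr : p - q \is Num.real.
  have := pq 1 ltr01; rewrite -lerBlDl => /ler_real ->.
  by rewrite ger0_real// mul1r addr_ge0.
rewrite -subr_le0 real_leNgt//; apply/negP.
have {}pq e : 0 < e -> p - q <= e * (e + k) by move=> /pq; rewrite lerBlDl.
move: (p - q) pq => t pq t0 {pqr}.
have kt : 0 < 1 + k + t by rewrite addr_gt0.
(* For this [e] one has [e <= 1], hence [e * (e + k) <= e * (1 + k) < t], a contradiction. *)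
have e0 : 0 < t / (1 + k + t) by rewrite divr_gt0.
have := pq _ e0; apply/negP; move: (e0) => /gtr0_real er.
rewrite -real_ltNge ?gtr0_real//; last by rewrite mulr_gt0// ltr_wpDr.
have e1 : t / (1 + k + t) <= 1 by rewrite ler_pdivrMr// mul1r lerDr ltW.
apply: (@le_lt_trans _ _ (t / (1 + k + t) * (1 + k))).
  by rewrite ler_wpM2l ?lerD2r// ltW.
by rewrite mulrAC ltr_pdivrMr// ltr_pM2l// ltrDl.
Qed.

End numeric_bounds.

(** * Riesz representation on the range of a linear map *)

Definition linear_subspace (C : numClosedFieldType) (V : lmodType C) (D : set V) :=
  D 0 /\ forall a x y, D x -> D y -> D (a *: x + y).

Section riesz_range.
Variables (R : realType) (V : lmodType R[i]) (G : hilbertType R[i]).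
Variables (D : set V) (L : V -> G).
Hypotheses (Dsub : linear_subspace D) (L_linear : linear L).

(* By homogeneity in [v] the quadratic bound is [|phi v| <= sqrt c |L v|], but it
   needs no square root. The last clause says that [h] lies in the closure of
   [L @` D], which makes it unique. [h] is the limit of [L v] along minimizers of
   [E]: by the parallelogram identity near-minimizers are close in [G]. *)
Lemma riesz_on_range (phi : V -> R[i]) (c : R[i]) :
  scalar phi -> (forall v, D v -> phi v + (phi v)^* <= c + `|L v| ^+ 2) ->
  exists h : G, [/\ forall v, D v -> phi v = '[L v, h], `|h| ^+ 2 <= c
    & forall z, (forall v, D v -> '[L v, z] = 0) -> '[h, z] = 0].
Proof.
move=> phi_linear phi_le; have [D0 DP] := Dsub.
have phiD x y : phi (x + y) = phi x + phi y.
  by have := phi_linear 1 x y; rewrite scale1r mul1r.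
have phi0 : phi 0 = 0 by apply: (addIr (phi 0)); rewrite -phiD !addr0 add0r.
have phiZ a x : phi (a *: x) = a * phi x.
  by have := phi_linear a x 0; rewrite !addr0 phi0 addr0.
have LD x y : L (x + y) = L x + L y.
  by have := L_linear 1 x y; rewrite !scale1r.
have L0 : L 0 = 0 by apply: (addIr (L 0)); rewrite -LD !addr0 add0r.
have LZ a x : L (a *: x) = a *: L x.
  by have := L_linear a x 0; rewrite !addr0 L0 addr0.
have DD x y : D x -> D y -> D (x + y).
  by move=> Dx Dy; rewrite -[x]scale1r; exact: DP.
have DZ a x : D x -> D (a *: x) by move=> Dx; rewrite -[_ *: _]addr0; exact: DP.
(* If [phi v = '[L v, h]], then [E v] is |L v - h|^2 - |h|^2, so minimizing [E] moves [L v] towards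
   [h]. *)
pose E v := `|L v| ^+ 2 - (phi v + (phi v)^*).
have c0 : 0 <= c.
  by have := phi_le 0 D0; rewrite phi0 L0 rmorph0 addr0 normr0 expr0n addr0.
have E_ge v : D v -> - c <= E v.
  by move=> /phi_le; rewrite /E lerBrDr [- c + _]addrC lerBlDl.
have [|||m [mE Em]] := @complex_infimum R (E @` D) (- c).
- by exists (E 0), 0.
- by rewrite rpredN ger0_real.
- by move=> _ [v Dv <-]; exact: E_ge.
have {}mE v : D v -> m <= E v by move=> Dv; apply: mE; exists v.
(* The tolerance is [e ^+ 2] so that the parallelogram identity bounds distances by [2 * e]. *)
pose A e := [set x | exists2 v, D v & x = L v /\ E v <= m + e ^+ 2].
have [||||h hA] := @cauchy_family_limit R G A 2.
- by [].
- move=> e e0; have [_ [v Dv <-] /ltW vm] := Em (e ^+ 2) (exprn_gt0 2 e0).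
  by exists (L v), v.
- move=> e e' e0 ee' x [v Dv [-> vm]]; exists v => //; split=> //.
  by rewrite (le_trans vm)// lerD2l ler_sqr ?nnegrE// ltW// (lt_le_trans e0).
- move=> e _ _ e0 [v Dv [-> vm]] [v' Dv' [-> v'm]].
  have e2 : 0 <= 2 * e by rewrite mulr_ge0// ltW.
  rewrite -ler_sqr ?nnegrE//.
  have -> : `|L v - L v'| ^+ 2 = 2 * (E v + E v') - 4 * E (2^-1 *: (v + v')).
    rewrite /E LZ LD phiZ phiD normrZ exprMn sqr_normB sqr_normD.
    rewrite ger0_norm ?invr_ge0// rmorphM/= rmorphD/= fmorphV/= rmorph_nat.
    by field.
  have -> : (2 * e) ^+ 2 = 2 * (m + e ^+ 2 + (m + e ^+ 2)) - 4 * m by ring.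
  have m2 : m <= E (2^-1 *: (v + v')) by apply/mE/DZ/DD.
  by apply: lerB; rewrite ler_pM2l// lerD.
have hphi x : D x -> phi x = '[L x, h].
  move=> Dx; apply/esym/eqP; rewrite -subr_eq0; set w := _ - _.
  (* First variation: [E (v - a *: x)] is at least [m], which [E v] exceeds by at most [e ^+ 2];
     replacing [L v] by [h] in the cross term costs a further multiple of [e]. *)
  have key a : a * w + (a * w)^* <= `|a| ^+ 2 * `|L x| ^+ 2.
    apply: (@ler_quadratic_eps _ (2 * (`|a| * `|L x|))) => [|e e0].
      by rewrite !mulr_ge0.
    have [_ [v Dv [-> vm]] vh] := hA e e0.
    have vax : m <= E (v - a *: x).
      by apply: mE; rewrite addrC -scaleNr; exact: DP.
    have EE : E (v - a *: x) = E v + `|a| ^+ 2 * `|L x| ^+ 2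
        + (a * '[L x, h - L v] + (a * '[L x, h - L v])^*)
        - (a * w + (a * w)^*).
      rewrite /E -scaleNr LD LZ phiD phiZ scaleNr sqr_normB normrZ exprMn innerZr.
      rewrite innerBr /w (innerC (L v) (L x)).
      rewrite !(rmorphM, rmorphB, rmorphD, rmorphN)/= !conjCK.
      by ring.
    move: vax; rewrite EE lerBrDr -lerBrDl => /le_trans; apply.
    rewrite lerBlDl.
    have := addCconj_le (a * '[L x, h - L v]).
    have le2 : 2 * `|a * '[L x, h - L v]| <= e * (2 * (`|a| * `|L x|)).
      rewrite normrM [leRHS]mulrCA ler_pM2l// [leRHS]mulrCA ler_wpM2l//.
      rewrite [leRHS]mulrC.
      apply: le_trans (CauchySchwarz_inner _ _) _.
      by rewrite ler_wpM2l// distrC ltW.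
    move=> /le_trans/(_ le2) le3.
    rewrite (le_trans (lerD (lerD vm (lexx _)) le3))//.
    rewrite le_eqVlt; apply/orP; left; apply/eqP; ring.
  apply/negPn/negP => w0.
  set n := `|L x| ^+ 2 in key; have n1 : 0 < n + 1 by rewrite ltr_pwDr// exprn_ge0.
  have w_gt0 : 0 < `|w| by rewrite normr_gt0.
  have w2 : 0 < `|w| ^+ 2 by rewrite exprn_gt0.
  (* The linear term becomes 2|w|^2/(n+1), which exceeds the quadratic one, n|w|^2/(n+1)^2. The
     [+ 1] keeps the denominator positive when [L x = 0]. *)
  have := key ((n + 1)^-1 * w^*).
  have nr : (n + 1)^-1 \is Num.real by rewrite rpredV gtr0_real.
  have -> : (n + 1)^-1 * w^* * w = (n + 1)^-1 * `|w| ^+ 2.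
    by rewrite -mulrA normCKC.
  rewrite rmorphM/= (CrealP nr) (CrealP (gtr0_real w2)).
  rewrite normrM norm_conjC exprMn (ger0_norm (ltW _)) ?invr_gt0//.
  apply/negP; rewrite -real_ltNge//.
  - have -> : (n + 1)^-1 * `|w| ^+ 2 + (n + 1)^-1 * `|w| ^+ 2 =
      (n + 1)^-1 ^+ 2 * `|w| ^+ 2 * (n + n + 2).
      by field; rewrite gt_eqF.
    rewrite ltr_pM2l ?mulr_gt0// ?invr_gt0//.
    by rewrite -addrA ltrDl ltr_wpDl// exprn_ge0.
  - apply: rpredM; last by rewrite rpredX// normr_real.
    by apply: rpredM; [exact: rpredX | exact: gtr0_real].
  - by apply: rpredD; apply: rpredM => //; exact: gtr0_real.
exists h; split=> //.
- apply: (@ler_quadratic_eps _ 0) => // e e0; rewrite addr0 -expr2.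
  have [_ [v Dv [-> vm]] vh] := hA e e0.
  have -> : `|h| ^+ 2 = `|L v - h| ^+ 2 - E v.
    by rewrite /E sqr_normB hphi//; ring.
  rewrite addrC lerD//; first by rewrite lerNl E_ge.
  by rewrite ler_sqr ?nnegrE// ltW.
- move=> z zL; apply/eqP; rewrite -normr_le0.
  (* [z] is orthogonal to [L v], so ['[h, z] = '[h - L v, z]], of modulus at most e|z|. *)
  apply: (@ler_quadratic_eps _ `|z|) => // e e0; rewrite add0r.
  have [_ [v Dv [-> vm]] vh] := hA e e0.
  rewrite -[h](subrK (L v)) innerDl zL// addr0.
  apply: le_trans (CauchySchwarz_inner _ _) _.
  rewrite distrC; apply: ler_pM => //; first exact: ltW.
  by rewrite ler_wpDl// ltW.
Qed.

End riesz_range.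

(** [T x] is the vector representing [Phi x] in the closure of the range of [L] on [D]. Such vectors
    are determined by their pairings with the range, which gives both the linearity of [T] and the
    last clause. *)
Lemma riesz_operator (R : realType) (V : lmodType R[i]) (G X : hilbertType R[i])
    (D : set V) (L : V -> G) (Phi : X -> V -> R[i]) (q : X -> R[i]) (M : R[i]) :
  linear_subspace D -> linear L ->
  (forall x, scalar (Phi x)) ->
  (forall a x y v, Phi (a *: x + y) v = a^* * Phi x v + Phi y v) ->
  0 <= M -> (forall x, q x <= (M * `|x|) ^+ 2) ->
  (forall x v, D v -> Phi x v + (Phi x v)^* <= q x + `|L v| ^+ 2) ->
  exists T : {bounded X -> G},
    [/\ forall x v, D v -> '[L v, T x] = Phi x v,
        forall x, `|T x| ^+ 2 <= q x
      & forall x w, D w -> (forall v, D v -> Phi x v = '[L v, L w]) ->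
          T x = L w].
Proof.
move=> Dsub L_linear Phil Phir M0 qM Phiq.
have ex x := cid (riesz_on_range Dsub L_linear (Phil x) (Phiq x)).
pose T x := projT1 (ex x).
have TP x : [/\ forall v, D v -> Phi x v = '[L v, T x], `|T x| ^+ 2 <= q x
    & forall z, (forall v, D v -> '[L v, z] = 0) -> '[T x, z] = 0].
  by rewrite /T; case: (ex x).
have orth_eq0 z : (forall v, D v -> '[L v, z] = 0) ->
    ((forall v, D v -> '[L v, z] = 0) -> '[z, z] = 0) -> z = 0.
  move=> zL /(_ zL) /eqP; rewrite inner_norm sqrf_eq0 normr_eq0.
  by move/eqP.
have T_linear : linear T.
  move=> a x y; apply/eqP; rewrite -subr_eq0; apply/eqP.
  have [axy1 _ axy2] := TP (a *: x + y).
  have [x1 _ x2] := TP x; have [y1 _ y2] := TP y.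
  apply: orth_eq0 => [v Dv|zL].
    by rewrite innerBr innerDr innerZr -axy1// -x1// -y1// Phir subrr.
  by rewrite innerBl innerDl innerZl axy2// x2// y2// mulr0 addr0 subr0.
have T_bounded : exists N, forall x, `|T x| <= N * `|x|.
  exists M => x; rewrite -ler_sqr ?nnegrE ?mulr_ge0//.
  by have [_ Tq _] := TP x; exact: le_trans Tq (qM x).
exists (Bop T_linear T_bounded); split=> [x v Dv|x|x w Dw Phiw] /=.
- by have [-> ] := TP x.
- by have [] := TP x.
- have [x1 _ x2] := TP x; apply/eqP; rewrite -subr_eq0; apply/eqP.
  apply: orth_eq0 => [v Dv|zL].
    by rewrite innerBr -x1// Phiw// subrr.
  by rewrite innerBl x2// zL// subr0.
Qed.

(** * Norms of adjoints and inversion of perturbations of the identity *)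

Section adjoints.
Variable R : realType.

Lemma adjointPr (H K : hilbertType R[i]) (T : {bounded H -> K}) x y :
  '[adjoint T y, x] = '[y, T x].
Proof. by rewrite innerC -adjointP -innerC. Qed.

(** Cauchy-Schwarz gives |T^* y|^2 = <T T^* y, y> <= r |T^* y| |y|, and one factor cancels. *)
Lemma adjoint_opnorm_le (H K : hilbertType R[i]) (T : {bounded H -> K}) r :
  0 <= r -> opnorm_le T r -> opnorm_le (adjoint T) r.
Proof.
move=> r0 Tr y; have [->|z0] := eqVneq (adjoint T y) 0.
  by rewrite normr0 mulr_ge0.
have z_gt0 : 0 < `|adjoint T y| by rewrite normr_gt0.
rewrite -(ler_pM2l z_gt0) -expr2 -inner_norm -adjointP.
rewrite -[leLHS]ger0_norm; last by rewrite adjointP inner_norm exprn_ge0.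
apply: le_trans (CauchySchwarz_inner _ _) _.
by rewrite mulrCA mulrA ler_wpM2r.
Qed.

Lemma opnorm_le_comp (H K L : hilbertType R[i]) (S : {bounded K -> L})
    (T : {bounded H -> K}) r s : 0 <= s ->
  opnorm_le S s -> opnorm_le T r -> opnorm_le (S \o T)%BO (s * r).
Proof.
move=> s0 Ss Tr x /=; apply: le_trans (Ss _) _.
by rewrite -mulrA ler_wpM2l.
Qed.

(* [1 - T^*] is bounded below, so representing [z |-> <z, y>] on its range solves
   [(1 - T) x = y]; no Neumann series is needed. *)
Lemma invertible_id_sub (H : hilbertType R[i]) (T : {bounded H -> H}) r :
  0 <= r < 1 -> opnorm_le T r -> invertible (bop_id - T).
Proof.
move=> /andP[r0 r1] Tr; set d := 1 - r.
have d0 : 0 < d by rewrite subr_gt0.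
have lower (P : {bounded H -> H}) : opnorm_le P r ->
    forall x, d * `|x| <= `|(bop_id - P) x|.
  move=> Pr x; rewrite bopBE /d mulrBl mul1r.
  apply: le_trans (lerB_dist _ _); exact: lerB.
have Ts := adjoint_opnorm_le r0 Tr.
pose L := bop_id - adjoint T.
have DT : linear_subspace [set: H] by [].
have [|||||T' [T'P _ _]] := @riesz_operator R H H H setT L
  (fun y z => '[z, y]) (fun y => (d^-1 * `|y|) ^+ 2) d^-1 DT (bop_linear L).
- by move=> y a z z'; rewrite innerP.
- by move=> a x y v; rewrite innerPr.
- by rewrite invr_ge0 ltW.
- by [].
- move=> y z _.
  (* The weights [d^-1] and [d] in 2ab <= a^2 + b^2 are chosen so that [lower] absorbs the second
     square into |L z|^2. *)
  apply: (@le_trans _ _ ((d^-1 * `|y|) ^+ 2 + (d * `|z|) ^+ 2)); last first.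
    rewrite lerD2l ler_sqr ?nnegrE ?mulr_ge0 ?lower//; exact: ltW.
  apply: le_trans (addCconj_le _) _.
  apply: le_trans (ler_wpM2l _ (CauchySchwarz_inner _ _)) _ => //.
  rewrite -subr_ge0.
  have -> : (d^-1 * `|y|) ^+ 2 + (d * `|z|) ^+ 2 - 2 * (`|z| * `|y|) =
      (d^-1 * `|y| - d * `|z|) ^+ 2 by field; rewrite gt_eqF.
  by rewrite real_exprn_even_ge0// rpredB// rpredM ?normr_real// ?rpredV gtr0_real.
have right y : (bop_id - T) (T' y) = y.
  apply: inner_inj => z; rewrite -(T'P y z I) /L !bopBE.
  by rewrite innerBr innerBl adjointPr.
(* [1 - T] is bounded below, hence injective, so its right inverse [T'] is also a left inverse. *)
have inj x y : (bop_id - T) x = (bop_id - T) y -> x = y.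
  move=> xy; apply/eqP; rewrite -subr_eq0 -normr_le0.
  rewrite -(pmulr_rle0 _ d0) (le_trans (lower _ Tr _))//.
  have -> : (bop_id - T) (x - y) = 0; last by rewrite normr0.
  by apply/eqP; rewrite linearB subr_eq0; apply/eqP.
exists T'; split; apply: bop_ext => x /=; last exact: right.
by apply: inj; exact: right.
Qed.

End adjoints.

(** * The row operator Z(l) on the ball *)

Section row_operator.
Variables (R : realType) (d : nat).

Lemma adjoint_ZrowE (H : hilbertType R[i]) (l : 'rV[R[i]]_d) (x : H) :
  adjoint (Zrow H l) x = [ffun j => (l 0 j)^* *: x] :> hpow H d.
Proof.
apply: inner_inj => v; rewrite -adjointP hpow_innerE /= inner_suml.
by apply: eq_bigr => j _; rewrite ffunE innerZl innerZr conjCK.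
Qed.

Lemma cdot_ge0 (l : 'rV[R[i]]_d) : 0 <= cdot l l.
Proof. by apply: sumr_ge0 => j _; rewrite mul_conjC_ge0. Qed.

Lemma adjoint_Zrow_opnorm (H : hilbertType R[i]) (l : 'rV[R[i]]_d) :
  opnorm_le (adjoint (Zrow H l)) (sqrtC (cdot l l)).
Proof.
move=> x; rewrite -ler_sqr ?nnegrE ?mulr_ge0 ?sqrtC_ge0 ?cdot_ge0//.
rewrite exprMn hpow_normE sqrtCK mulr_suml adjoint_ZrowE.
by apply: ler_sum => j _; rewrite ffunE normrZ norm_conjC exprMn normCK.
Qed.

Lemma Zrow_opnorm (H : hilbertType R[i]) (l : 'rV[R[i]]_d) :
  opnorm_le (Zrow H l) (sqrtC (cdot l l)).
Proof.
have -> : Zrow H l = adjoint (adjoint (Zrow H l)).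
  by apply: bop_ext => v; apply: inner_inj => z; rewrite -adjointP adjointPr.
by apply: adjoint_opnorm_le (@adjoint_Zrow_opnorm H l); rewrite sqrtC_ge0 cdot_ge0.
Qed.

Lemma sqrt_cdot_lt1 (l : ball_d R d) : 0 <= sqrtC (cdot l l) < 1.
Proof.
rewrite sqrtC_ge0 cdot_ge0/= -ltr_sqr ?nnegrE ?sqrtC_ge0 ?cdot_ge0//.
by rewrite sqrtCK expr1n; case: l.
Qed.

(** Coordinatewise 2ab <= a^2 + b^2 gives 2|<l, z>| <= <l, l> + <z, z> < 2, so the denominator of
    K_S never vanishes. *)
Lemma cdot_neq1 (l z : ball_d R d) : 1 - cdot l z != 0.
Proof.
have lt : `|cdot l z| * 2 < 2.
  have -> : 2 = 1 + 1 :> R[i] by [].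
  apply: le_lt_trans (ltrD (svalP l) (svalP z)).
  rewrite mulrDr mulr1 /cdot -big_split/=.
  apply: le_trans (lerD (ler_norm_sum _ _ _) (ler_norm_sum _ _ _)) _.
  rewrite -big_split/=; apply: ler_sum => j _.
  rewrite normrM norm_conjC -!normCK -subr_ge0.
  set a := `|_|; set b := `|_|.
  have -> : a ^+ 2 + b ^+ 2 - (a * b + a * b) = (a - b) ^+ 2 by ring.
  by rewrite real_exprn_even_ge0// rpredB// normr_real.
apply/eqP => /eqP; rewrite subr_eq0 => /eqP lz1.
by move: lt; rewrite -lz1 normr1 mul1r ltxx.
Qed.

End row_operator.

(** * Linear spans, coordinates and pairings *)

Section linear_span.
Variables (C : numClosedFieldType) (V : lmodType C) (A : set V).

Lemma lspan_subspace : linear_subspace (lspan A).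
Proof.
split=> [|a _ _ [m [c [v [Av ->]]]] [n [b [w [Aw ->]]]]].
  by exists 0, (fun=> 0), (fun=> 0); split=> [[]//|]; rewrite big_ord0.
pose coef (i : 'I_(m + n)) :=
  match fintype.split i with inl j => a * c j | inr k => b k end.
pose vec (i : 'I_(m + n)) :=
  match fintype.split i with inl j => v j | inr k => w k end.
exists (m + n)%N, coef, vec; split=> [i|].
  by rewrite /vec; case: fintype.split.
rewrite big_split_ord/= scaler_sumr; congr (_ + _); apply: eq_bigr => i _.
  by rewrite /coef /vec (unsplitK (inl i)) scalerA.
by rewrite /coef /vec (unsplitK (inr i)).
Qed.

Lemma sub_lspan v : A v -> lspan A v.
Proof.
move=> Av; exists 1, (fun=> 1), (fun=> v); split=> //.
by rewrite big_ord1 scale1r.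
Qed.

Lemma lspan_ind (P : set V) :
  linear_subspace P -> A `<=` P -> lspan A `<=` P.
Proof.
move=> [P0 PP] AP _ [n [c [v [Av ->]]]].
elim/big_ind: _ => [//|x y Px Py|i _]; first by rewrite -[x]scale1r; exact: PP.
by rewrite -[_ *: _]addr0; apply: PP => //; exact: AP.
Qed.

End linear_span.

Lemma hsum_inner_pair (C : numClosedFieldType) (H K : hilbertType C)
    (x x' : H) (y y' : K) :
  '[(x, y) : hsum H K, (x', y') : hsum H K] = '[x, x'] + '[y, y'].
Proof. by []. Qed.

Section coordinate_operators.
Variables (C : numClosedFieldType) (H K : hilbertType C) (d : nat).

Let fst_bounded : exists M : C, forall x : hsum H K, `|x.1| <= M * `|x|.
Proof. by exists 1 => x; rewrite mul1r hsum_norm_fst. Qed.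

Definition fst_op : {bounded hsum H K -> H} :=
  @Bop C (hsum H K) H (fun x => x.1) (fun _ _ _ => erefl) fst_bounded.

Let snd_bounded : exists M : C, forall x : hsum H K, `|x.2| <= M * `|x|.
Proof. by exists 1 => x; rewrite mul1r hsum_norm_snd. Qed.

Definition snd_op : {bounded hsum H K -> K} :=
  @Bop C (hsum H K) K (fun x => x.2) (fun _ _ _ => erefl) snd_bounded.

Let coord_linear j : linear (fun x : hpow H d => x j).
Proof. by move=> a x y; rewrite !ffunE. Qed.

Let coord_bounded j : exists M : C, forall x : hpow H d, `|x j| <= M * `|x|.
Proof. by exists 1 => x; rewrite mul1r hpow_norm_coord. Qed.

Definition coord_op j : {bounded hpow H d -> H} :=
  Bop (coord_linear j) (coord_bounded j).

End coordinate_operators.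
Arguments coord_op {C} H {d} j.

Section pairing.
Variables (C : numClosedFieldType) (X H K : hilbertType C).
Variables (S : {bounded X -> H}) (T : {bounded X -> K}).

Let pair_linear : linear (fun x => (S x, T x) : hsum H K).
Proof. by move=> a x y; rewrite !linearP. Qed.

Let pair_bounded : exists M : C, forall x, `|(S x, T x) : hsum H K| <= M * `|x|.
Proof.
have [M SM] := bop_bounded S; have [N TN] := bop_bounded T.
exists (M + N) => x; rewrite mulrDl; apply: le_trans (hsum_norm_sum _) _.
exact: lerD (SM x) (TN x).
Qed.

Definition pair_op : {bounded X -> hsum H K} := Bop pair_linear pair_bounded.

End pairing.

Local Arguments adjoint : simpl never.

(** * The lurking isometry and the existence of state operators *)

Section model.
Variables (R : realType) (d : nat) (U Y : hilbertType R[i]).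
Variables (S : ball_d R d -> {bounded U -> Y}) (H : rkhs (KS S)).

Definition source (z : ball_d R d) (y : Y) : hsum (hpow H d) Y :=
  (adjoint (Zrow H z) (rkhs_kernel H z y), y).

Definition target (z : ball_d R d) (y : Y) : hsum H U :=
  (rkhs_kernel H z y, adjoint (S z) y).

(** Spanning pairs makes the isometry linear by construction; equality of the norms of the two
    components then makes it single-valued. *)
Definition lurking_graph : set (hsum (hsum (hpow H d) Y) (hsum H U)) :=
  lspan [set v | exists z y, v = (source z y, target z y)].

(** With K = <k_z y, k_w y'>, clearing the denominator 1 - <w, z> in K_S yields <w, z> K + <y, y'> =
    K + <S(z)^* y, S(w)^* y'>. *)
Lemma kernel_inner (z w : ball_d R d) (y y' : Y) :
  '[source z y, source w y'] = '[target z y, target w y'].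
Proof.
rewrite /source /target !hsum_inner_pair hpow_innerE !adjoint_ZrowE.
have -> : \sum_(j < d) '[[ffun j => (z 0 j)^* *: rkhs_kernel H z y] j,
    [ffun j => (w 0 j)^* *: rkhs_kernel H w y'] j] =
    cdot w z * '[rkhs_kernel H z y, rkhs_kernel H w y'].
  rewrite /cdot mulr_suml; apply: eq_bigr => j _.
  by rewrite !ffunE innerZl innerZr conjCK mulrA [_ * w 0 j]mulrC.
rewrite -adjointP.
rewrite rkhs_reproducing rkhs_kernelE /KS bopZE bopBE /= innerZl innerBl.
by field; exact: cdot_neq1.
Qed.

Lemma lurking_graph_gen z y : lurking_graph (source z y, target z y).
Proof. by apply: sub_lspan; exists z, y. Qed.

Lemma lurking_graph_inner v w : lurking_graph v -> lurking_graph w ->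
  '[v.1, w.1] = '[v.2, w.2].
Proof.
move=> gv gw; move: v gv; apply: lspan_ind.
  split=> [|a x y xw yw]; first by rewrite !inner0l.
  by rewrite !innerP xw yw.
move=> _ [z [y ->]]; move: w gw; apply: lspan_ind.
  split=> [|a x x' xw yw]; first by rewrite !inner0r.
  by rewrite !innerPr xw yw.
by move=> _ [z' [y' ->]]; exact: kernel_inner.
Qed.

Lemma lurking_graph_norm v : lurking_graph v -> `|v.1| = `|v.2|.
Proof.
move=> gv; apply/eqP; rewrite -(@eqrXn2 _ 2)// -!inner_norm.
by rewrite lurking_graph_inner.
Qed.

Lemma kernel_eval (f : H) z y : '[rkhs_kernel H z y, f] = '[y, rkhs_eval f z].
Proof. by rewrite innerC rkhs_reproducing -innerC. Qed.

Lemma eval_Zrow (l : ball_d R d) (x : hpow H d) z :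
  rkhs_eval (Zrow H l x) z = \sum_(j < d) l 0 j *: rkhs_eval (x j) z.
Proof.
have eP := @rkhs_eval_linear _ _ _ _ H z.
have eD (x1 x2 : H) : rkhs_eval (x1 + x2) z = rkhs_eval x1 z + rkhs_eval x2 z.
  by have := eP 1 x1 x2; rewrite !scale1r.
have e0 : rkhs_eval (0 : H) z = 0.
  by apply: (addIr (rkhs_eval (0 : H) z)); rewrite -eD !addr0 add0r.
rewrite /= (big_morph (fun f : H => rkhs_eval f z) eD e0).
by apply: eq_bigr => j _; have := eP (l 0 j) (x j) 0; rewrite e0 !addr0.
Qed.

Lemma rkhs_evalB (f g : H) z :
  rkhs_eval (f - g) z = rkhs_eval f z - rkhs_eval g z.
Proof.
have := @rkhs_eval_linear _ _ _ _ H z (-1) g f.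
by rewrite !scaleN1r ![- _ + _]addrC.
Qed.

Lemma Zrow_origin (x : hpow H d) : Zrow H (@ball_origin R d) x = 0.
Proof. by rewrite /= big1// => j _; rewrite mxE scale0r. Qed.

Lemma source_origin y : source ball_origin y = (0, y).
Proof.
congr (_, _); apply: inner_inj => x.
by rewrite -adjointP Zrow_origin inner0l inner0r.
Qed.

Lemma source_part_linear :
  linear (fun v : hsum (hsum (hpow H d) Y) (hsum H U) => v.1).
Proof. by []. Qed.

Lemma exists_difference_quotients : exists A : 'I_d -> {bounded H -> H},
  (forall (f : H) (l : ball_d R d), rkhs_eval f l - rkhs_eval f ball_origin =
     \sum_(j < d) l 0 j *: rkhs_eval (A j f) l) /\
  (forall f : H, \sum_(j < d) `|A j f| ^+ 2 <=
     `|f| ^+ 2 - `|rkhs_eval f ball_origin| ^+ 2).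
Proof.
have [|||||T [TP Tle _]] := @riesz_operator R _ (hsum (hpow H d) Y) H
  lurking_graph (fun v => v.1) (fun f v => '[v.2.1, f]) (fun f => `|f| ^+ 2) 1
  (lspan_subspace _) source_part_linear.
- by move=> f a v w; rewrite -innerP.
- by move=> a f g v; rewrite innerPr.
- by [].
- by move=> f; rewrite mul1r.
(* Twice the real part of <a, f> is at most |f|^2 + |a|^2; here a is [v.2.1], whose norm is at most
   that of [v.2], equal to that of [v.1]. *)
- move=> f v gv; apply: (@le_trans _ _ (`|f| ^+ 2 + `|v.2.1| ^+ 2)).
    rewrite -subr_ge0 [X in X - _]addrC.
    by rewrite -sqr_normB exprn_ge0.
  by rewrite lerD2l lurking_graph_norm// ler_sqr ?nnegrE// hsum_norm_fst.
(* Pairing [T f] with [source l y] for all [y] gives (i) with [(T f).1] in the role of [A f]; at the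
   origin Z vanishes, so [(T f).2] is f(0). *)
have evalE (f : H) (l : ball_d R d) :
    rkhs_eval f l = rkhs_eval (Zrow H l (T f).1) l + (T f).2.
  apply: inner_inj => y; have := TP f _ (lurking_graph_gen l y).
  by rewrite hsum_innerE /source adjointPr !kernel_eval innerDr.
have eval0 (f : H) : rkhs_eval f ball_origin = (T f).2.
  by rewrite evalE eval_Zrow big1 ?add0r// => j _; rewrite mxE scale0r.
exists (fun j => (coord_op H j \o (fst_op _ _ \o T))%BO); split=> [f l|f].
  by rewrite eval0 evalE addrK eval_Zrow.
have := Tle f; rewrite hsum_normE hpow_normE eval0 lerBrDr.
by [].
Qed.

End model.
Arguments lurking_graph {R d U Y S} H _.

Lemma bop_compE (C : numClosedFieldType) (H K L : hilbertType C)
    (S : {bounded K -> L}) (T : {bounded H -> K}) x :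
  (S \o T)%BO x = S (T x).
Proof. by []. Qed.

Lemma bop_idE (C : numClosedFieldType) (H : hilbertType C) (x : H) :
  bop_id x = x.
Proof. by []. Qed.

(** * Weakly coisometric realization with given state operators *)

Section realization_of_model.
Variables (R : realType) (d : nat) (U Y : hilbertType R[i]).
Variables (S : ball_d R d -> {bounded U -> Y}) (H : rkhs (KS S)).
Variable A : 'I_d -> {bounded H -> H}.
Hypothesis Adiff : forall (f : H) (l : ball_d R d),
  rkhs_eval f l - rkhs_eval f ball_origin =
  \sum_(j < d) l 0 j *: rkhs_eval (A j f) l.
Hypothesis Anorm : forall f : H,
  \sum_(j < d) `|A j f| ^+ 2 <= `|f| ^+ 2 - `|rkhs_eval f ball_origin| ^+ 2.

Let A_contractive : opnorm_le (column A) 1.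
Proof.
move=> f; rewrite mul1r -ler_sqr ?nnegrE// hpow_normE.
under eq_bigr do rewrite columnE.
by apply: le_trans (Anorm f) _; rewrite gerBl exprn_ge0.
Qed.

Let C_bounded : exists M : R[i], forall f : H,
  `|rkhs_eval f ball_origin| <= M * `|f|.
Proof.
exists 1 => f; rewrite mul1r -ler_sqr ?nnegrE//.
rewrite -subr_ge0; apply: le_trans (Anorm f).
by apply: sumr_ge0 => j _; rewrite exprn_ge0.
Qed.

Let C : {bounded H -> Y} := Bop (@rkhs_eval_linear _ _ _ _ H ball_origin) C_bounded.

Let T := pair_op (column A) C.
Let Q := adjoint T.

Let T_contractive : opnorm_le T 1.
Proof.
move=> f; rewrite mul1r -ler_sqr ?nnegrE// hsum_normE hpow_normE.
by under eq_bigr do rewrite columnE; rewrite -lerBrDr Anorm.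
Qed.

Let Q_contractive g : `|Q g| <= `|g|.
Proof. by have := adjoint_opnorm_le ler01 T_contractive g; rewrite mul1r. Qed.

Let eval_AE (f : H) (l : ball_d R d) :
  rkhs_eval f l = rkhs_eval (Zrow H l (column A f)) l + C f.
Proof.
rewrite eval_Zrow; apply/eqP; rewrite -subr_eq Adiff; apply/eqP.
by apply: eq_bigr => j _; rewrite columnE.
Qed.

(** This is (i) at [z] in adjoint form. After inversion of I - A^* Z(z)^* it identifies the
    generators of [weak_domain] as Z(z)^* k_z y. *)
Let kernel_AE (z : ball_d R d) (y : Y) :
  (bop_id - (adjoint (column A) \o adjoint (Zrow H z))%BO)
  (rkhs_kernel H z y) = adjoint C y.
Proof.
apply: inner_inj => f; rewrite bopBE innerBr bop_idE bop_compE -!adjointP.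
by rewrite !rkhs_reproducing [rkhs_eval f z]eval_AE innerDl addrAC subrr add0r.
Qed.

Let Q_source (z : ball_d R d) (y : Y) : Q (source H z y) = rkhs_kernel H z y.
Proof.
apply: inner_inj => f; rewrite -adjointP /source hsum_innerE -adjointP.
by rewrite !rkhs_reproducing -innerDl -eval_AE.
Qed.

Let Q_graph v : lurking_graph H v -> Q v.1 = v.2.1.
Proof.
move: v; apply: lspan_ind => [|_ [z [y ->]]]; last exact: Q_source.
split=> [|a x y xE yE]; first exact: linear0.
by transitivity (a *: Q x.1 + Q y.1); [exact: linearP | rewrite xE yE].
Qed.

Let output_part_linear :
  linear (fun v : hsum (hsum (hpow H d) Y) (hsum H U) => v.2.2).
Proof. by []. Qed.

Let exists_W : exists W : {bounded hsum (hpow H d) Y -> U},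
  (forall g, `|Q g| ^+ 2 + `|W g| ^+ 2 <= `|g| ^+ 2) /\
  (forall v, lurking_graph H v -> W v.1 = v.2.2).
Proof.
have [|||||W [_ Wle WE]] := @riesz_operator R _ U (hsum (hpow H d) Y)
  (lurking_graph H) (fun v => v.2.2) (fun g v => '[v.1, g] - '[v.2.1, Q g])
  (fun g => `|g| ^+ 2 - `|Q g| ^+ 2) 1 (lspan_subspace _) output_part_linear.
- move=> g a v w; transitivity ((a * '[v.1, g] + '[w.1, g]) -
    (a * '[v.2.1, Q g] + '[w.2.1, Q g])); first by rewrite -!innerP.
  by rewrite /=; ring.
- by move=> a f g v; rewrite (linearP Q) !innerPr; ring.
- by [].
- by move=> g; rewrite mul1r gerBl exprn_ge0.
(* The bound is the positivity of q at [g - v.1]: once |v.1|^2 is split as |v.2.1|^2 + |v.2.2|^2,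
   the terms |v.2.1|^2 cancel. *)
- move=> g v gv; have := Q_contractive (g - v.1).
  have QB x y : Q (x - y) = Q x - Q y by exact: linearB.
  rewrite -ler_sqr ?nnegrE// QB !sqr_normB (Q_graph gv).
  rewrite (lurking_graph_norm gv) (hsum_normE v.2).
  rewrite (innerC g) (innerC (Q g)) !conjCK -subr_ge0 => h.
  rewrite -subr_ge0; apply: le_trans h _; rewrite rmorphB.
  by rewrite le_eqVlt; apply/orP; left; apply/eqP; ring.
exists W; split=> [g|v gv]; first by rewrite addrC -lerBrDr Wle.
(* On the graph, the isometry reduces q(w.1, v.1) to ['[w.2.2, v.2.2]]. *)
apply: WE => // w gw; rewrite lurking_graph_inner// Q_graph//.
by rewrite hsum_innerE addrAC subrr add0r.
Qed.

(* The second component is free because [source H ball_origin y = (0, y)]. *)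
Let lspan_lift a y :
  lspan [set v | exists (z : ball_d R d) (y : Y),
    v = adjoint (Zrow H z)
      (bop_inv (bop_id - (adjoint (column A) \o adjoint (Zrow H z))%BO)
        (adjoint C y))] a ->
  exists2 v, lurking_graph H v & v.1 = (a, y).
Proof.
have [g0 gP] : linear_subspace (lurking_graph H) by exact: lspan_subspace.
have gD v w : lurking_graph H v -> lurking_graph H w -> lurking_graph H (v + w).
  by move=> gv gw; rewrite -[v]scale1r; exact: gP.
have origin y' : exists2 v, lurking_graph H v & v.1 = (0, y').
  exists (source H ball_origin y', target H ball_origin y').
    exact: lurking_graph_gen.
  exact: source_origin.
move=> ga; move: a ga y; apply: lspan_ind.
  split=> // b x x' xP x'P y.
  have [v gv vE] := xP 0; have [w gw wE] := x'P y.
  exists (b *: v + w); first exact: gP.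
  rewrite /= vE wE; congr (_, _); by rewrite /= scaler0 add0r.
(* [source z y0] has second component [y0]; a source at the origin supplies the difference
   [y - y0]. *)
move=> _ [z [y0 ->]] y; have [w gw wE] := origin (y - y0).
exists ((source H z y0, target H z y0) + w).
  by apply: gD => //; exact: lurking_graph_gen.
have inv : invertible (bop_id - (adjoint (column A) \o adjoint (Zrow H z))%BO).
  apply: (invertible_id_sub (sqrt_cdot_lt1 z)); rewrite -[sqrtC _]mul1r.
  apply: opnorm_le_comp => //; last exact: adjoint_Zrow_opnorm.
  exact: adjoint_opnorm_le.
have [invl _] := bop_invP inv.
rewrite -(kernel_AE z).
have := congr1 (fun P : {bounded H -> H} => P (rkhs_kernel H z y0)) invl.
move=> invlE; rewrite [X in adjoint _ X]invlE.
by rewrite /= wE; congr (_, _); rewrite /= ?addr0// addrC subrK.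
Qed.

Lemma weakly_coisometric_realization :
  exists (B : 'I_d -> {bounded U -> H}) (C : {bounded H -> Y})
         (D : {bounded U -> Y}),
    [/\ forall f : H, C f = rkhs_eval f ball_origin,
        realizes A B C D S
      & weakly_coisometric A B C D].
Proof.
have [W [QW W_graph]] := exists_W.
(* The second column of the connecting operator is W^*, which makes its adjoint g |-> (Q g, W g). *)
pose B j := (coord_op H j \o (fst_op _ _ \o adjoint W))%BO.
pose D := (snd_op _ _ \o adjoint W)%BO.
have BE u : column B u = (adjoint W u).1.
  by apply/ffunP => j; rewrite columnE.
exists B, C, D; split=> //.
  move=> l; have inv : invertible (bop_id - (Zrow H l \o column A)%BO).
    apply: (invertible_id_sub (sqrt_cdot_lt1 l)); rewrite -[sqrtC _]mulr1.
    apply: opnorm_le_comp => //; last exact: Zrow_opnorm.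
    by have /andP[] := sqrt_cdot_lt1 l.
  split=> //; apply: bop_ext => u; rewrite bopDE !bop_compE.
  set x := bop_inv _ (Zrow H l (column B u)).
  have xE : x - Zrow H l (column A x) = Zrow H l (column B u).
    have [_ invr] := bop_invP inv.
    have := congr1 (fun P : {bounded H -> H} => P (Zrow H l (column B u))) invr.
    by rewrite bop_compE bopBE bop_compE.
  (* By (i), [x - Z(l) A x] takes the value [C x] at [l]; this removes the inverse from the transfer
     function. *)
  have CE : C x = rkhs_eval (Zrow H l (column B u)) l.
    by rewrite -xE rkhs_evalB [rkhs_eval x l]eval_AE addrAC subrr add0r.
  (* [W] sends [source l y] to S(l)^* y, so <S(l) u, y> is the pairing of W^* u = (B u, D u) with
     [source l y]. *)
  rewrite CE; apply: inner_injl => y.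
  rewrite adjointP -[adjoint (S l) y](W_graph _ (lurking_graph_gen H l y)).
  rewrite -adjointPr hsum_innerE [in X in _ + X = _]/= addrC innerDl.
  congr (_ + _); rewrite -rkhs_reproducing -BE.
  exact/esym/adjointP.
have adjE g : adjoint (connecting_op A B C D) g = (Q g, W g).
  apply: inner_inj => x; rewrite -adjointP [RHS]hsum_innerE.
  have connE : connecting_op A B C D x = T x.1 + adjoint W x.2.
    transitivity ((column A x.1 + column B x.2, C x.1 + D x.2) :
      hsum (hpow H d) Y) => //.
    by rewrite BE.
  by rewrite connE innerDl adjointP adjointPr.
have adj_contr : contractive (adjoint (connecting_op A B C D)).
  by move=> g; rewrite -ler_sqr ?nnegrE// adjE hsum_normE QW.
have graph_iso v : lurking_graph H v ->
    `|adjoint (connecting_op A B C D) v.1| = `|v.1|.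
  by move=> gv; rewrite adjE Q_graph// W_graph// lurking_graph_norm//; case: v.2.
split=> // g wg; set P := adjoint _ in adj_contr graph_iso *.
apply: le_anti; rewrite adj_contr/=.
(* Some graph vector [v] has [v.1] within [e] of [g]. Isometry at [v.1] and contractivity on
   [g - v.1] give |g| <= e + (|P g| + e); the 2 counts these two errors. *)
apply: (@ler_quadratic_eps _ 2) => // e e0.
have [a' [ga' aa']] := wg _ (nbhsx_ballx g.1 e e0).
have [v gv vE] := lspan_lift g.2 ga'.
have dist : `|g - v.1| <= e.
  apply: le_trans (hsum_norm_sum _) _; rewrite vE.
  have -> : (g - (a', g.2)).2 = 0 by rewrite /= subrr.
  by rewrite normr0 addr0 ltW//; move: aa'; rewrite -ball_normE.
have Pv : P v.1 = P g - P (g - v.1).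
  have -> : P (g - v.1) = P g - P v.1 by exact: linearB.
  by rewrite opprB addrC subrK.
have v_le : `|v.1| <= `|P g| + e.
  rewrite -(graph_iso _ gv) Pv; apply: le_trans (ler_normB _ _) _.
  by rewrite lerD2l (le_trans (adj_contr _)).
rewrite -[X in `|X|](subrK v.1 g); apply: le_trans (ler_normD _ _) _.
apply: le_trans (lerD dist v_le) _; rewrite addrCA lerD2l.
have -> : e * (e + 2) = e * e + (e + e) by ring.
by rewrite lerDr mulr_ge0// ltW.
Qed.

End realization_of_model.

Theorem theorem3p1 (R : realType) (d : nat) (U Y : hilbertType R[i])
    (Hk : scalar_rkhs (@kd R d))
    (HU : vector_rkhs Hk U) (HY : vector_rkhs Hk Y)
    (S : ball_d R d -> {bounded U -> Y}) (HS : schur_class HU HY S)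
    (HKS : rkhs (KS S)) :
  let difference_quotient (A : 'I_d -> {bounded HKS -> HKS}) :=
    forall (f : HKS) (l : ball_d R d),
      rkhs_eval f l - rkhs_eval f ball_origin =
      \sum_(j < d) l 0 j *: rkhs_eval (A j f) l in
  let norm_inequality (A : 'I_d -> {bounded HKS -> HKS}) :=
    forall f : HKS,
      \sum_(j < d) `|A j f| ^+ 2 <= `|f| ^+ 2 - `|rkhs_eval f ball_origin| ^+ 2 in
  (exists A : 'I_d -> {bounded HKS -> HKS},
     difference_quotient A /\ norm_inequality A) /\
  (forall A : 'I_d -> {bounded HKS -> HKS},
     difference_quotient A -> norm_inequality A ->
     exists (B : 'I_d -> {bounded U -> HKS}) (C : {bounded HKS -> Y})
            (D : {bounded U -> Y}),
       [/\ forall f : HKS, C f = rkhs_eval f ball_origin,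
           realizes A B C D S
         & weakly_coisometric A B C D]).
Proof.
move=> difference_quotient norm_inequality; split.
  exact: exists_difference_quotients.
by move=> A; exact: weakly_coisometric_realization.
Qed.
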